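(* For every $n\ge1$, $\widehat{\mathrm{P}}^{\mathrm{VAL}_n}=\widehat{\mathrm{P}}^{\mathrm{SAT}_n}$.
   Context: $\Sigma=\{0,1\}$, $\Sigma^*$ the finite nonempty binary strings; for $x\in\Sigma^m$, $\pi_1(x)=x_1$. $\mathbb{P}_+\Sigma=\{\{0\},\{1\},\Sigma\}$. A promise problem is $\phi:\Sigma^*\to\mathbb{P}_+\Sigma$; a problem $\psi:\Sigma^*\to\Sigma$ is identified with $x\mapsto\{\psi(x)\}$. A $\phi$-oracle Turing machine may, given $x$, obtain in unit time some $y\in\phi(x)$; when $\phi(x)=\Sigma$ the returned value is nondeterministic (adversarial), independently on each call. $\phi_1\propto_T\phi_2$ means there is a $\phi_2$-oracle Turing machine $M$ and a polynomial $p$ such that on every input $x$ every possible computation path halts within $p(|x|)$ steps and outputs an element of $\phi_1(x)$. $\widehat{\mathrm{P}}^{\phi}=\{\phi_1:\phi_1\propto_T\phi\}$. Level-$n$ problems: the input encodes (e.g. as a Boolean formula) $f:\Sigma^{m_1}\times\dots\times\Sigma^{m_n}\to\Sigma$, written $f(x,\dots)$ with $x\in\Sigma^{m_1}$; $f_x$ is $f$ with $x$ fixed. For a constant $c$, $\mathrm{SAT}_0(c)=\overline{\mathrm{SAT}}_0(c)=c$; for $n\ge1$, $\mathrm{SAT}_n(f)=1\iff\exists x:\overline{\mathrm{SAT}}_{n-1}(f_x)=1$, $\overline{\mathrm{SAT}}_n(f)=1\iff\forall x,\ \mathrm{SAT}_{n-1}(f_x)=1$, and $\mathrm{VAL}_n(f)=\{\pi_1x:\overline{\mathrm{SAT}}_{n-1}(f_x)=1\}$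 if $\mathrm{SAT}_n(f)=1$, else $\Sigma$. *)

(* Defs.v *)
From mathcomp Require Import all_boot.
Set Implicit Arguments. Unset Strict Implicit. Unset Printing Implicit Defensive.

(* Promise problems.  Sigma^* is modelled by [seq bool]; a promise     *)
(* problem phi : Sigma^* -> P_+ Sigma is modelled as a relation         *)
(* [phi x y] meaning "y \in phi(x)".  Nonemptiness of phi(x) is        *)
(* imposed as a hypothesis where needed ([is_promise]).                 *)
Definition promise := seq bool -> bool -> Prop.

Definition is_promise (phi : promise) : Prop :=
  forall x : seq bool, 0 < size x -> exists y, phi x y.

Definition of_problem (psi : seq bool -> bool) : promise :=
  fun x y => y = psi x.

(* One two-way infinite work tape over a finite alphabet G (with a     *)
(* blank), initially holding the input; a write-only oracle (query)     *)
(* tape to which the machine appends bits; a finite set of states Q.    *)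
(* In one step the machine either                                       *)
(*   - writes a symbol, moves the head, optionally appends a bit to the *)
(*     query tape and changes state ([Act]);                            *)
(*   - queries the oracle on the current query-tape word w, obtaining   *)
(*     (nondeterministically) some y \in phi(w); the query tape is      *)
(*     erased and the next state depends on y ([Ask]);                  *)
(*   - halts with output b \in Sigma ([Stop]).                          *)
Inductive move := MoveL | MoveR | Stay.

Inductive action (Q G : Type) :=
  | Act of Q & G & move & option bool
  | Ask of (bool -> Q)
  | Stop of bool.

Record tape (G : Type) := Tape { tleft : seq G; thead : G; tright : seq G }.

Definition tape_write G (t : tape G) (w : G) : tape G :=
  Tape (tleft t) w (tright t).

Definition tape_move G (blank : G) (d : move) (t : tape G) : tape G :=
  match d with
  | Stay => t
  | MoveL => match tleft t with
             | [::] => Tape [::] blank (thead t :: tright t)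
             | a :: l => Tape l a (thead t :: tright t)
             end
  | MoveR => match tright t with
             | [::] => Tape (thead t :: tleft t) blank [::]
             | a :: r => Tape (thead t :: tleft t) a r
             end
  end.

Record OTM := {
  otm_Q : finType;
  otm_G : finType;
  otm_blank : otm_G;
  otm_sym : bool -> otm_G;
  otm_start : otm_Q;
  otm_delta : otm_Q -> otm_G -> action otm_Q otm_G }.

Record config (M : OTM) := Config {
  cstate : otm_Q M; ctape : tape (otm_G M); cquery : seq bool }.

Definition init_config (M : OTM) (x : seq bool) : config M :=
  Config (otm_start M)
    (match x with
     | [::] => Tape [::] (otm_blank M) [::]
     | b :: x' => Tape [::] (otm_sym M b) (map (otm_sym M) x')
     end) [::].

Fixpoint all_paths_ok (M : OTM) (orc : promise) (S : bool -> Prop)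
    (t : nat) (c : config M) {struct t} : Prop :=
  match t with
  | 0 => False
  | t'.+1 =>
    match otm_delta (cstate c) (thead (ctape c)) with
    | Stop b => S b
    | Act q' w d ob =>
        all_paths_ok orc S t'
          (Config q' (tape_move (otm_blank M) d (tape_write (ctape c) w))
                  (cquery c ++ (if ob is Some b then [:: b] else [::])))
    | Ask f =>
        forall y, orc (cquery c) y ->
          all_paths_ok orc S t' (Config (f y) (ctape c) [::])
    end
  end.

Definition peval (p : seq nat) (n : nat) : nat :=
  \sum_(i < size p) nth 0 p i * n ^ i.

Definition Treduces (phi1 phi2 : promise) : Prop :=
  exists (M : OTM) (p : seq nat),
    forall x : seq bool, 0 < size x ->
      @all_paths_ok M phi2 (phi1 x) (peval p (size x)) (init_config M x).

Definition Phat (phi : promise) : promise -> Prop :=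
  fun phi1 => Treduces phi1 phi.

(* Level-n instances: encoding of f : Sigma^{m_1} x ... x Sigma^{m_n}   *)
(* -> Sigma as a Boolean formula.                                       *)
(* Variables are numbered 0,1,...; block i consists of the m_i         *)
(* consecutive variables after those of blocks 1..i-1.                  *)
(* Encoding of an instance (m_1,...,m_n ; phi) as a bit string:         *)
(*   1^{m_1} 0 1^{m_2} 0 ... 1^{m_n} 0  tokens(phi)                     *)
(* where phi is written in reverse Polish notation with the prefix-free *)
(* token code  VAR k = 1 1^k 0,  NOT = 00,  AND = 010,  OR = 011.       *)
(* Strings that are not valid encodings (some m_i = 0, syntax error,    *)
(* variable out of range) are treated as unsatisfiable instances.       *)
Inductive form :=
  | FVar of nat
  | FNot of form
  | FAnd of form & form
  | FOr of form & form.

Fixpoint feval (env : nat -> bool) (f : form) : bool :=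
  match f with
  | FVar k => env k
  | FNot a => ~~ feval env a
  | FAnd a b => feval env a && feval env b
  | FOr a b => feval env a || feval env b
  end.

Fixpoint fbound (N : nat) (f : form) : bool :=
  match f with
  | FVar k => k < N
  | FNot a => fbound N a
  | FAnd a b => fbound N a && fbound N b
  | FOr a b => fbound N a && fbound N b
  end.

Inductive token := TVar of nat | TNot | TAnd | TOr.

Fixpoint tokenize (s : seq bool) (cur : option nat) : option (seq token) :=
  match cur, s with
  | Some k, true :: s' => tokenize s' (Some k.+1)
  | Some k, false :: s' => omap (cons (TVar k)) (tokenize s' None)
  | Some _, [::] => None
  | None, [::] => Some [::]
  | None, true :: s' => tokenize s' (Some 0)
  | None, false :: false :: s' => omap (cons TNot) (tokenize s' None)
  | None, false :: true :: false :: s' => omap (cons TAnd) (tokenize s' None)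
  | None, false :: true :: true :: s' => omap (cons TOr) (tokenize s' None)
  | None, _ => None
  end.

Fixpoint rpn (ts : seq token) (st : seq form) : option (seq form) :=
  match ts with
  | [::] => Some st
  | t :: ts' =>
    match t, st with
    | TVar k, _ => rpn ts' (FVar k :: st)
    | TNot, a :: st' => rpn ts' (FNot a :: st')
    | TAnd, b :: a :: st' => rpn ts' (FAnd a b :: st')
    | TOr, b :: a :: st' => rpn ts' (FOr a b :: st')
    | _, _ => None
    end
  end.

Fixpoint parse_unary (s : seq bool) (acc : nat) : option (nat * seq bool) :=
  match s with
  | [::] => None
  | true :: s' => parse_unary s' acc.+1
  | false :: s' => Some (acc, s')
  end.

Fixpoint parse_header (n : nat) (s : seq bool) : option (seq nat * seq bool) :=
  match n with
  | 0 => Some ([::], s)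
  | n'.+1 =>
    match parse_unary s 0 with
    | None => None
    | Some (m, s') =>
      match parse_header n' s' with
      | None => None
      | Some (ms, s'') => Some (m :: ms, s'')
      end
    end
  end.

Definition decode (n : nat) (s : seq bool) : option (seq nat * form) :=
  match parse_header n s with
  | None => None
  | Some (ms, rest) =>
    if all (fun m => 0 < m) ms then
      match tokenize rest None with
      | None => None
      | Some ts =>
        match rpn ts [::] with
        | Some [:: f] => if fbound (sumn ms) f then Some (ms, f) else None
        | _ => None
        end
      end
    else None
  end.

Definition extend (env : nat -> bool) (off m : nat) (t : m.-tuple bool) :
  nat -> bool :=
  fun i => if (off <= i) && (i < off + m) then nth false t (i - off) else env i.

(* qval true ms off env f  = SAT_{|ms|} of f with variables < off fixed by env;
   qval false ms off env f = co-SAT_{|ms|} (\overline{SAT}) likewise;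
   for ms = [::] this is the value of the constant. *)
Fixpoint qval (q : bool) (ms : seq nat) (off : nat) (env : nat -> bool)
    (f : form) : bool :=
  match ms with
  | [::] => feval env f
  | m :: ms' =>
    if q then [exists t : m.-tuple bool, qval false ms' (off + m) (extend env off t) f]
    else [forall t : m.-tuple bool, qval true ms' (off + m) (extend env off t) f]
  end.

Definition env0 : nat -> bool := fun _ => false.

Definition SATfun (n : nat) (x : seq bool) : bool :=
  match decode n x with
  | Some (ms, f) => qval true ms 0 env0 f
  | None => false
  end.

Definition SAT (n : nat) : promise := of_problem (SATfun n).

Definition VAL (n : nat) : promise :=
  fun s y =>
    match decode n s with
    | Some (m :: ms, f) =>
        if qval true (m :: ms) 0 env0 f then
          exists t : m.-tuple bool,
            nth false t 0 = y /\ qval false ms m (extend env0 0 t) f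
        else True
    | _ => True
    end.

(* Main.v *)
Require Import Defs.
From HB Require Import structures.
From mathcomp Require Import all_boot.
From mathcomp Require Import zify.
Set Implicit Arguments. Unset Strict Implicit. Unset Printing Implicit Defensive.

(** Playing only the first block would not be enough: it would leave a universal question with one
    block less, which is again as hard as an oracle query and is not what the oracle answers. Every
    block is therefore played to the end, and what remains is a formula without free variables,
    decided by plain evaluation. An answer of VAL is a single bit, so the game moves bit by bit
    rather than block by block. No move has to be checked: in a position where the oracle is
    unconstrained, every move preserves the value. Reverse Polish notation matters in both
    directions. Conjunction with [x_0] and negation only append tokens, and substitution acts on
    each token separately, so queries are produced in single passes over a string that has never
    been parsed as a formula. Errors in the header or in the token code are caught before the game;
    stack errors and variables out of range surface only in the last evaluation. Answers may vary
    from call to call. This is harmless, because correctness is stated for all computation paths and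
    each simulated query only has to receive some admissible answer. *)

(** A VAL query [f] is answered by the SAT query [f /\ x_0]: if it is satisfiable then
    [1] is the first bit of a witness, and otherwise every witness starts with [0].

    Conversely, SAT_n is the value of a game in which the bits of all the blocks are
    chosen one after the other, by an existential or a universal player.  VAL_n, asked
    about [f] restricted to the bits chosen so far, or about its negation when the
    universal player moves, gives a move that preserves the value of the game, so SAT_n
    is the value of [f] at the bits finally reached.  Ill-formed inputs are played in the
    same way with meaningless answers, and are recognized when the formula is evaluated.

    Both procedures, and the simulation of a given oracle machine with its queries
    answered by them, are programs over finitely many stacks; these are turned into
    one-tape machines by storing each stack on a track of the tape. *)

(** * Stack programs *)

Section StackPrograms.
Variables (I Gam : finType).

Definition store := {ffun I -> seq Gam}.

Definition upd (st : store) (i : I) (s : seq Gam) : store :=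
  [ffun j => if j == i then s else st j].

Inductive instr (S : Type) :=
  | ISkip of S
  | IPush of I & Gam & S
  | IPop of I & (option Gam -> S)
  | IEmit of bool & S
  | IAsk of (bool -> S).

Definition imap S S' (g : S -> S') (c : instr S) : instr S' :=
  match c with
  | ISkip s => ISkip (g s)
  | IPush i a s => IPush i a (g s)
  | IPop i f => IPop i (g \o f)
  | IEmit b s => IEmit b (g s)
  | IAsk f => IAsk (g \o f)
  end.

Record prog (A : Type) := Prog {
  pstate : finType;
  pstart : pstate;
  pstep : pstate -> instr (pstate + A) }.

Variable orc : promise.

(** The fuel [t] is an upper bound and not an exact count: [Post] is tested as soon as a value is
    returned, whatever fuel is left. As in [all_paths_ok], the oracle's answers are quantified
    universally. *)
Fixpoint exec (Q A : Type) (step : Q -> instr (Q + A)) (t : nat) (s : Q + A)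
    (st : store) (w : seq bool) (Post : A -> store -> seq bool -> Prop) : Prop :=
  match s with
  | inr a => Post a st w
  | inl q =>
    match t with
    | 0 => False
    | t'.+1 =>
      match step q with
      | ISkip s' => exec step t' s' st w Post
      | IPush i a s' => exec step t' s' (upd st i (a :: st i)) w Post
      | IPop i f => exec step t' (f (ohead (st i))) (upd st i (behead (st i))) w Post
      | IEmit b s' => exec step t' s' st (w ++ [:: b]) Post
      | IAsk f => forall y, orc w y -> exec step t' (f y) st [::] Post
      end
    end
  end.

Definition run A (p : prog A) t st w Post := exec (@pstep A p) t (inl (pstart p)) st w Post.

Lemma exec_mono Q A (step : Q -> instr (Q + A)) t t' s st w
    (P P' : A -> store -> seq bool -> Prop) :
  t <= t' -> (forall a st' w', P a st' w' -> P' a st' w') ->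
  exec step t s st w P -> exec step t' s st w P'.
Proof.
move=> + PP'; elim: t t' s st w => [|t IH] [|t'] [q|a] st w //= le_t; try exact: PP'.
case: (step q) => [s|i a s|i f|b s|f] //=; try exact: IH.
by move=> H y /H; exact: IH.
Qed.

Lemma run_mono A (p : prog A) t t' st w (P P' : A -> store -> seq bool -> Prop) :
  t <= t' -> (forall a st' w', P a st' w' -> P' a st' w') ->
  run p t st w P -> run p t' st w P'.
Proof. exact: exec_mono. Qed.

Lemma run_less A (p : prog A) t t' st w (P : A -> store -> seq bool -> Prop) :
  t <= t' -> run p t st w P -> run p t' st w P.
Proof. by move=> le_t; exact: run_mono. Qed.

(** A step pushes at most one symbol. This bounds the residue that [decide] has to clear, without
    any description of what it contains. *)
Lemma exec_size Q A (step : Q -> instr (Q + A)) t s st w P :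
  exec step t s st w P ->
  exec step t s st w
    (fun a st' w' => P a st' w' /\ forall i, size (st' i) <= size (st i) + t).
Proof.
elim: t s st w => [|t IH] [q|a] st w //=.
- by move=> H; split=> // i; rewrite addn0.
- case: (step q) => [s|i a s|i f|b s|f] /=.
  + move/IH; apply: exec_mono => // a st' w' [HP Hs]; split=> // i.
    by have := Hs i; lia.
  + move/IH; apply: exec_mono => // a' st' w' [HP Hs]; split=> // j.
    by have := Hs j; rewrite ffunE; case: eqP => [->|_] /=; lia.
  + move/IH; apply: exec_mono => // a' st' w' [HP Hs]; split=> // j.
    by have := Hs j; rewrite ffunE; case: eqP => [->|_]; rewrite ?size_behead; lia.
  + move/IH; apply: exec_mono => // a st' w' [HP Hs]; split=> // i.
    by have := Hs i; lia.
  + move=> H y /H /IH; apply: exec_mono => // a st' w' [HP Hs]; split=> // i.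
    by have := Hs i; lia.
- by move=> H; split=> // i; lia.
Qed.

Lemma run_size A (p : prog A) t st w P :
  run p t st w P ->
  run p t st w (fun a st' w' => P a st' w' /\ forall i, size (st' i) <= size (st i) + t).
Proof. exact: exec_size. Qed.

Definition pskip A (a : A) : prog A := @Prog A unit tt (fun _ => ISkip (inr a)).
Definition ppush i a : prog unit := @Prog unit unit tt (fun _ => IPush i a (inr tt)).
Definition ppop i : prog (option Gam) :=
  @Prog (option Gam) unit tt (fun _ => IPop i (fun o => inr o)).
Definition pemit b : prog unit := @Prog unit unit tt (fun _ => IEmit b (inr tt)).
Definition pask : prog bool := @Prog bool unit tt (fun _ => IAsk (fun y => inr y)).

Section Bind.
Variables (A : finType) (B : Type) (p : prog A) (f : A -> prog B).

Definition bind_fst (s : pstate p + A) : (pstate p + {a : A & pstate (f a)}) + B :=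
  match s with
  | inl q => inl (inl q)
  | inr a => inl (inr (Tagged (fun a => pstate (f a)) (pstart (f a))))
  end.

Definition bind_snd a (s : pstate (f a) + B) : (pstate p + {a : A & pstate (f a)}) + B :=
  match s with
  | inl q => inl (inr (Tagged (fun a => pstate (f a)) q))
  | inr b => inr b
  end.

(** The intermediate result is the tag of a dependent sum, so the state set is finite because [A]
    is. Returning from [p] leads directly into the start state of [f a], so running times add
    without overhead. *)
Definition pbind : prog B :=
  @Prog B (pstate p + {a : A & pstate (f a)})%type (inl (pstart p))
    (fun s => match s with
              | inl q => imap bind_fst (pstep q)
              | inr (existT a q) => imap (@bind_snd a) (pstep q)
              end).

Lemma run_bind t1 t st w P : t1 <= t ->
  run p t1 st w (fun a st' w' => run (f a) (t - t1) st' w' P) -> run pbind t st w P.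
Proof.
have snd_ok a t2 s st' w' : exec (@pstep B (f a)) t2 s st' w' P ->
    exec (@pstep B pbind) t2 (bind_snd s) st' w' P.
  elim: t2 s st' w' => [|t2 IH] [q|b] st' w' //=.
  case: (pstep q) => [s|i c s|i g|c s|g] //=; try exact: IH.
  by move=> H y /H; exact: IH.
have fst_ok t2 s st' w' : exec (@pstep A p) t1 s st' w'
     (fun a st2 w2 => run (f a) t2 st2 w2 P) ->
    exec (@pstep B pbind) (t1 + t2) (bind_fst s) st' w' P.
  elim: t1 s st' w' => [|t' IH] [q|a] st' w'.
  - by [].
  - by move=> H; apply: (snd_ok a t2 (inl _)).
  - change (t'.+1 + t2) with (t' + t2).+1 => /=; case: (pstep q) => [s|i c s|i g|c s|g] /=; try exact: IH.
    by move=> H y /H; exact: IH.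
  - move=> H; apply: (@exec_mono _ _ _ t2 _ _ _ _ P P); [lia|by []|].
    exact: (snd_ok a t2 (inl _)).
by move=> le_t H; rewrite -(subnKC le_t); exact: (fst_ok _ (inl _)).
Qed.

End Bind.

Section Loop.
Variables (A : finType) (B : Type) (body : A -> prog (A + B)).

Definition loop_ret a (s : pstate (body a) + (A + B)) : {a : A & pstate (body a)} + B :=
  match s with
  | inl q => inl (Tagged (fun a => pstate (body a)) q)
  | inr (inl a') => inl (Tagged (fun a => pstate (body a)) (pstart (body a')))
  | inr (inr b) => inr b
  end.

Definition ploop (a : A) : prog B :=
  @Prog B {a : A & pstate (body a)} (Tagged (fun a => pstate (body a)) (pstart (body a)))
    (fun s => match s with existT a q => imap (@loop_ret a) (pstep q) end).

Lemma run_loop t1 t a st w P : t1 <= t ->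
  run (body a) t1 st w (fun r st' w' =>
    match r with
    | inl a' => run (ploop a') (t - t1) st' w' P
    | inr b => P b st' w'
    end) ->
  run (ploop a) t st w P.
Proof.
have ok t2 s st' w' : exec (@pstep _ (body a)) t1 s st' w' (fun r st' w' =>
    match r with
    | inl a' => run (ploop a') t2 st' w' P
    | inr b => P b st' w'
    end) ->
    exec (@pstep B (ploop a)) (t1 + t2) (loop_ret s) st' w' P.
  elim: t1 s st' w' => [|t' IH] [q|[a'|b]] st' w' //.
  - by case: t2.
  - rewrite addSn /=; case: (pstep q) => [s|i c s|i g|c s|g] /=; try exact: IH.
    by move=> H y /H; exact: IH.
  - move=> H; apply: (@exec_mono _ _ _ t2 _ _ _ _ P P) => //; lia.
by move=> le_t H; rewrite -(subnKC le_t); exact: (ok _ (inl _)).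
Qed.

End Loop.

Lemma run_skip A (a : A) t (st : store) w P : 0 < t -> P a st w -> run (pskip a) t st w P.
Proof. by case: t => [|[]]. Qed.

Lemma run_push (B : Type) i a (f : unit -> prog B) t (st : store) w P : 0 < t ->
  run (f tt) t.-1 (upd st i (a :: st i)) w P -> run (pbind (ppush i a) f) t st w P.
Proof. by move=> t0; rewrite -subn1 => H; apply: (@run_bind _ _ _ _ 1). Qed.

Lemma run_pop (B : Type) i (f : option Gam -> prog B) t (st : store) w P : 0 < t ->
  run (f (ohead (st i))) t.-1 (upd st i (behead (st i))) w P ->
  run (pbind (ppop i) f) t st w P.
Proof. by move=> t0; rewrite -subn1 => H; apply: (@run_bind _ _ _ _ 1). Qed.

Lemma run_emit (B : Type) b (f : unit -> prog B) t (st : store) w P : 0 < t ->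
  run (f tt) t.-1 st (w ++ [:: b]) P -> run (pbind (pemit b) f) t st w P.
Proof. by move=> t0; rewrite -subn1 => H; apply: (@run_bind _ _ _ _ 1). Qed.

Lemma run_ask (B : Type) (f : bool -> prog B) t (st : store) w P : 0 < t ->
  (forall y, orc w y -> run (f y) t.-1 st [::] P) -> run (pbind pask f) t st w P.
Proof. by move=> t0; rewrite -subn1 => H; apply: (@run_bind _ _ _ _ 1). Qed.

End StackPrograms.

Arguments pskip {I Gam A}.
Arguments pemit {I Gam}.
Arguments pask {I Gam}.
Arguments ppop {I Gam}.
Arguments ppush {I Gam}.

(** * Compilation to oracle Turing machines *)

(** In [CReady] the head is at cell 0, about to execute an instruction or to stop; [CWalk] and
    [CRead] climb to the top of a stack and read it; [CBack] returns to cell 0. The climbing states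
    carry only [q], from which [pstep q] recovers the instruction. *)
Inductive cstate_of (Q : Type) :=
  | CInit
  | CReady of (Q + bool)
  | CWalk of Q
  | CRead of Q
  | CBack of (Q + bool).
Arguments CInit {Q}.

Section CStateFinite.
Variable Q : finType.
Definition cs_code (c : cstate_of Q) : option ((Q + bool) + (Q + bool) + (Q + Q)) :=
  match c with
  | CInit => None
  | CReady s => Some (inl (inl s))
  | CBack s => Some (inl (inr s))
  | CWalk q => Some (inr (inl q))
  | CRead q => Some (inr (inr q))
  end.
Definition cs_decode (c : option ((Q + bool) + (Q + bool) + (Q + Q))) : cstate_of Q :=
  match c with
  | None => CInit
  | Some (inl (inl s)) => CReady s
  | Some (inl (inr s)) => CBack s
  | Some (inr (inl q)) => CWalk q
  | Some (inr (inr q)) => CRead q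
  end.
Lemma cs_codeK : cancel cs_code cs_decode. Proof. by case. Qed.
HB.instance Definition _ := Finite.copy (cstate_of Q) (can_type cs_codeK).
End CStateFinite.

(** * Tape contents as functions of the cell number *)

Section Tapes.
Variables (G : Type) (blank : G).

Definition tape_at (c : nat -> G) (L p : nat) : tape G :=
  Tape (rev (mkseq c p)) (c p) (mkseq (fun i => c (p.+1 + i)) (L - p.+1)).

(** A right move may create a blank, so tapes that differ in trailing blanks have the same contents;
    the number [L] of stored cells is hidden for this reason. *)
Definition represents (c : nat -> G) (p : nat) (tp : tape G) : Prop :=
  exists L, [/\ p < L, forall i, L <= i -> c i = blank & tp = tape_at c L p].

Lemma represents_head c p tp : represents c p tp -> Defs.thead tp = c p.
Proof. by case=> L [_ _ ->]. Qed.

Lemma represents_right c p tp :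
  represents c p tp -> represents c p.+1 (tape_move blank MoveR tp).
Proof.
(* From the last stored cell the move appends one blank, which makes the length [p.+2]; otherwise
   [L] is unchanged. *)
case=> L [ltpL cL ->]; exists (maxn L p.+2); split; first by lia.
  by move=> i Hi; apply: cL; lia.
rewrite /tape_at /tape_move /= mkseqS rev_rcons; have [le|lt] := leqP L p.+1.
  have -> : L - p.+1 = 0 by lia.
  have -> : maxn L p.+2 - p.+2 = 0 by lia.
  by rewrite /= (cL p.+1).
have -> : maxn L p.+2 - p.+2 = L - p.+2 by lia.
have -> : L - p.+1 = (L - p.+2).+1 by lia.
rewrite {1}/mkseq /= addn0; congr Tape.
rewrite (iotaDl 1 0) -map_comp; apply: eq_map => i /=.
by congr c; lia.
Qed.

Lemma represents_left c p tp :
  represents c p.+1 tp -> represents c p (tape_move blank MoveL tp).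
Proof.
case=> L [ltpL cL ->]; exists L; split=> //; first by lia.
rewrite /tape_at /tape_move /= mkseqS rev_rcons.
have -> : L - p.+1 = (L - p.+2).+1 by lia.
congr Tape; rewrite [RHS]/mkseq /= addn0; congr cons.
rewrite (iotaDl 1 0) -map_comp; apply: eq_map => i /=.
by congr c; lia.
Qed.

Lemma represents_write c c' p tp g :
  (forall i, c' i = if i == p then g else c i) ->
  represents c p tp -> represents c' p (tape_write tp g).
Proof.
move=> c'E [L [ltpL cL ->]]; exists L; split=> //.
  by move=> i Hi; rewrite c'E; case: eqP => [e|_]; [lia|exact: cL].
rewrite /tape_write /tape_at /= c'E eqxx; congr Tape.
  congr rev; apply/eq_in_map => i; rewrite mem_iota => /andP[_ Hi].
  by rewrite c'E; case: eqP => // e; lia.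
by apply: eq_map => i; rewrite c'E; case: eqP => // e; lia.
Qed.

Lemma tape_write_head (tp : tape G) : tape_write tp (Defs.thead tp) = tp.
Proof. by case: tp. Qed.

End Tapes.

Lemma all_paths_mono M orc S t t' (c : config M) :
  t <= t' -> all_paths_ok orc S t c -> all_paths_ok orc S t' c.
Proof.
elim: t t' c => [|t IH] [|t'] c //= le_t.
case: (otm_delta _ _) => [q g d ob|f|b] //; first exact: IH.
by move=> H y /H; exact: IH.
Qed.

(** * The one-tape machine of a stack program *)

Section Compile.
Variables (I Gam : finType) (p : prog I Gam bool) (i0 : I) (inb : bool -> Gam).

Definition cell := (bool * {ffun I -> option Gam})%type.

Definition set_track (g : cell) (i : I) (o : option Gam) : cell :=
  (g.1, [ffun j => if j == i then o else g.2 j]).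

Definition cblank : cell := (false, [ffun=> None]).

(** A pop on an empty track is answered at once: [CRead] is entered by a left move, which from cell
    0 would fall off the numbered cells. The [Stop] branches of the climbing states are only
    fillers, since these states are entered for pushes and pops alone. *)
Definition cdelta (c : cstate_of (pstate p)) (g : cell) :
    action (cstate_of (pstate p)) cell :=
  match c with
  | CInit => Act (CReady (inl (pstart p))) (true, g.2) Stay None
  | CReady (inr b) => Stop _ _ b
  | CReady (inl q) =>
    match pstep q with
    | ISkip s => Act (CReady s) g Stay None
    | IPush i a s => Act (CWalk q) g Stay None
    | IPop i f => if g.2 i is None then Act (CReady (f None)) g Stay None
                  else Act (CWalk q) g Stay None
    | IEmit b s => Act (CReady s) g Stay (Some b)
    | IAsk f => Ask _ (fun y => CReady (f y))
    end
  | CWalk q =>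
    match pstep q with
    | IPush i a s => if g.2 i is None then Act (CBack s) (set_track g i (Some a)) Stay None
                     else Act (CWalk q) g MoveR None
    | IPop i f => if g.2 i is None then Act (CRead q) g MoveL None
                  else Act (CWalk q) g MoveR None
    | _ => Stop _ _ false
    end
  | CRead q =>
    match pstep q with
    | IPop i f => Act (CBack (f (g.2 i))) (set_track g i None) Stay None
    | _ => Stop _ _ false
    end
  | CBack s => if g.1 then Act (CReady s) g Stay None else Act (CBack s) g MoveL None
  end.

Definition compile : OTM :=
  {| otm_Q := cstate_of (pstate p); otm_G := cell; otm_blank := cblank;
     otm_sym := fun b => set_track cblank i0 (Some (inb b));
     otm_start := CInit; otm_delta := cdelta |}.

(* Track [i] of the tape holds the stack [st i] with its bottom in the marked cell 0. *)
Definition cells (st : store I Gam) (n : nat) : cell :=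
  (n == 0, [ffun i => onth (rev (st i)) n]).

Variables (orc : promise) (S : bool -> Prop).

Local Notation ok t c tp w := (@all_paths_ok compile orc S t (@Config compile c tp w)).
Local Notation rep st := (represents cblank (cells st)).

Lemma act_stay t c c' (tp : tape cell) w :
  cdelta c (Defs.thead tp) = Act c' (Defs.thead tp) Stay None -> ok t c' tp w -> ok t.+1 c tp w.
Proof. by move=> /= -> /=; rewrite tape_write_head cats0. Qed.

Lemma act_move t c c' d (tp : tape cell) w :
  cdelta c (Defs.thead tp) = Act c' (Defs.thead tp) d None ->
  ok t c' (tape_move cblank d tp) w -> ok t.+1 c tp w.
Proof. by move=> /= -> /=; rewrite tape_write_head cats0. Qed.

Lemma back_ok t s (st : store I Gam) w :
  (forall tp, rep st 0 tp -> ok t (CReady s) tp w) ->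
  forall n tp, rep st n tp -> ok (t + n.+1) (CBack s) tp w.
Proof.
move=> H; elim=> [|n IH] tp Hr; rewrite addnS.
  rewrite addn0; apply: act_stay (H _ Hr).
  by rewrite /= (represents_head Hr).
apply: act_move (IH _ (represents_left Hr)).
by rewrite /= (represents_head Hr).
Qed.

Lemma onth_lt (T : Type) (s : seq T) n : n < size s -> exists a, onth s n = Some a.
Proof. by elim: s n => [|a s IH] [|n] //= Hn; [exists a|exact: IH]. Qed.

Lemma onth_ge (T : Type) (s : seq T) n : size s <= n -> onth s n = None.
Proof. by elim: s n => [|a s IH] [|n] //= Hn; exact: IH. Qed.

Lemma onth_rcons (T : Type) (s : seq T) (a : T) n :
  onth (rcons s a) n = if n == size s then Some a else onth s n.
Proof. by elim: s n => [[|[]]|b s IH [|n]] /=. Qed.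

Lemma walk_ok t q i (st : store I Gam) w :
  (forall g : cell, g.2 i -> cdelta (CWalk q) g = Act (CWalk q) g MoveR None) ->
  (forall tp, rep st (size (st i)) tp -> ok t (CWalk q) tp w) ->
  forall n d tp, n + d = size (st i) -> rep st n tp -> ok (t + d) (CWalk q) tp w.
Proof.
move=> Hq H n d; elim: d n => [|d IH] n tp e Hr.
  by rewrite addn0; apply: H; rewrite -e addn0.
rewrite addnS; apply: act_move (IH _ _ _ (represents_right Hr)); last by lia.
apply: Hq; rewrite (represents_head Hr) ffunE.
have [|a ->] := @onth_lt _ (rev (st i)) n; last by [].
by rewrite size_rev; lia.
Qed.

Lemma cells_push (st : store I Gam) i a n :
  cells (upd st i (a :: st i)) n =
  if n == size (st i) then set_track (cells st n) i (Some a) else cells st n.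
Proof.
case: ifP => e; rewrite /cells /set_track; congr pair; apply/ffunP => j; rewrite !ffunE;
  case: eqP => [e'|//]; rewrite ?e' rev_cons onth_rcons size_rev e //.
Qed.

Lemma cells_pop (st : store I Gam) i a s n : st i = a :: s ->
  cells (upd st i s) n = if n == size s then set_track (cells st n) i None else cells st n.
Proof.
move=> E; case: ifP => e; rewrite /cells /set_track; congr pair; apply/ffunP => j;
  rewrite !ffunE; case: eqP => [e'|//].
  by rewrite onth_ge // size_rev (eqP e).
by rewrite e' E rev_cons onth_rcons size_rev e.
Qed.

(** An instruction climbs at most one stack and returns, which takes at most [2 * B + 4] machine
    steps. The bound [size (st i) + t <= B] persists because the fuel drops by one while a stack
    gains at most one symbol. The last summand pays for [Stop]. *)
Lemma exec_compile B t s (st : store I Gam) w tp :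
  exec orc (@pstep _ _ _ p) t s st w (fun b _ _ => S b) ->
  (forall i, size (st i) + t <= B) -> rep st 0 tp ->
  ok (t * (2 * B + 4) + 1) (CReady s) tp w.
Proof.
case: s => [q|b] in tp *; last first.
  by rewrite addn1; case: t.
elim: t q st w tp => [//|t IH] q st w tp /= Hex HB Hr.
have IH' s' st' w' tp' : exec orc (@pstep _ _ _ p) t s' st' w' (fun b _ _ => S b) ->
    (forall i, size (st' i) + t <= B) -> rep st' 0 tp' ->
    ok (t * (2 * B + 4) + 1) (CReady s') tp' w'.
  case: s' => [q'|b'] H1 H2 H3; first exact: IH H1 H2 H3.
  by rewrite addn1; case: (t) H1.
have HB' i : size (st i) + t <= B by have := HB i; lia.
suff: ok ((t * (2 * B + 4) + 1) + (2 * B + 4)) (CReady (inl q)) tp w.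
  by apply: all_paths_mono; lia.
set T := t * _ + 1 in IH' *.
have one c : ok T.+1 c tp w -> ok (T + (2 * B + 4)) c tp w.
  by apply: all_paths_mono; lia.
case Eq: (pstep q) Hex => [s'|i a s'|i f|b s'|f] Hex.
- by apply: one; apply: act_stay (IH' _ _ _ _ Hex _ Hr); rewrite //= Eq.
- have HBi := HB i.
  apply: (@all_paths_mono _ _ _ ((T + (size (st i)).+1).+1 + size (st i)).+1); first by lia.
  apply: act_stay; first by rewrite /= Eq.
  apply: (@walk_ok _ q i st w _ _ 0) => //.
    by move=> g; rewrite /= Eq; case: (g.2 i).
  move=> tp' Hr' /=; rewrite Eq (represents_head Hr') ffunE.
  rewrite onth_ge ?size_rev //= cats0.
  apply: (@back_ok _ _ (upd st i (a :: st i))) => [tp2 Hr2|].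
    apply: (IH' _ _ _ _ Hex _ Hr2) => j; rewrite ffunE; have := HB j.
    by case: eqP => [->|_] /=; lia.
  apply: represents_write Hr' => n; rewrite cells_push.
  by case: eqP => [->|].
- case Est: (st i) Hex => [|a s] /= Hex.
    apply: one; apply: (act_stay (c' := CReady (f None))).
      by rewrite /= Eq (represents_head Hr) ffunE Est.
    apply: (IH' _ _ _ _ Hex) => [j|].
      by rewrite ffunE; have := HB' j; case: eqP => [->|_] /=; lia.
    suff -> : upd st i [::] = st by [].
    by apply/ffunP => j; rewrite ffunE; case: eqP => [->|].
  have HBi := HB i; rewrite Est /= in HBi.
  apply: (@all_paths_mono _ _ _ ((T + (size s).+1).+2 + size (st i)).+1).
    by rewrite Est /=; lia.
  apply: act_stay.
    by rewrite /= Eq (represents_head Hr) ffunE Est rev_cons; case: (rev s).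
  apply: (@walk_ok _ q i st w _ _ 0) => //.
    by move=> g; rewrite /= Eq; case: (g.2 i).
  move=> tp' Hr'; apply: (act_move (c' := CRead q) (d := MoveL)).
    by rewrite /= Eq (represents_head Hr') ffunE onth_ge // size_rev.
  rewrite Est /= in Hr'; have {}Hr' := represents_left Hr'.
  set tp2 := tape_move _ _ _ in Hr' *.
  move=> /=; rewrite Eq (represents_head Hr') ffunE /= cats0.
  rewrite Est rev_cons onth_rcons size_rev eqxx.
  apply: (@back_ok _ _ (upd st i s)) => [tp3 Hr3|].
    apply: (IH' _ _ _ _ Hex _ Hr3) => j; rewrite ffunE; have := HB' j.
    by case: eqP => [->|_]; rewrite ?Est /=; lia.
  apply: represents_write Hr' => n; rewrite (cells_pop _ Est).
  by case: eqP => [->|].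
- apply: one => /=; rewrite Eq /= tape_write_head.
  exact: IH' Hex _ Hr.
- by apply: one => /=; rewrite Eq => y /Hex /IH'; apply.
Qed.

(** Cell 0 holds the bottom of each stack and the first input bit, so the input appears as a
    reversed stack with its last bit on top. The two extra steps mark cell 0 and halt. *)
Lemma run_compile t x : 0 < size x ->
  run orc p t [ffun i => if i == i0 then rev (map inb x) else [::]] [::] (fun b _ _ => S b) ->
  @all_paths_ok compile orc S (t * (2 * (size x + t) + 4) + 2) (init_config compile x).
Proof.
set st := [ffun _ => _] => x0 Hrun; rewrite addnS /=.
apply: (exec_compile (st := st) Hrun) => [i|].
  by rewrite ffunE; case: eqP => _; rewrite ?size_rev ?size_map /=; lia.
have trk n : [ffun i => onth (rev (st i)) n] =
    (set_track cblank i0 (onth (map inb x) n)).2.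
  apply/ffunP => i; rewrite !ffunE /=; case: eqP => _; first by rewrite revK.
  by case: n.
exists (size x); case: x x0 {Hrun} @st trk => [//|b x] _ st trk; split=> //.
  move=> i Hi; rewrite /cells trk onth_ge ?size_map // /set_track /=.
  case: i Hi => // i _; congr pair; apply/ffunP => j.
  by rewrite !ffunE; case: eqP.
rewrite /tape_at /tape_write /=; congr Tape; first by rewrite /cells trk.
rewrite subn1 /=; apply: (@eq_from_nth _ cblank); first by rewrite size_map size_mkseq.
move=> n; rewrite size_map => Hn; rewrite nth_mkseq // /cells trk add1n /=.
rewrite (nth_map b) //; congr (set_track cblank i0 _).
by elim: x n Hn {st trk} => [|c x IH] [|n] //= Hn; exact: IH.
Qed.

End Compile.

(** * Polynomial bounds *)

(** With the positive base [n.+1] a single monomial suffices: exponents can be raised freely, and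
    [n = 0] is no exception. *)
Definition poly_bounded (g : nat -> nat) := exists C d, forall n, g n <= C * n.+1 ^ d.

Lemma poly_bounded_const c : poly_bounded (fun=> c).
Proof. by exists c, 0 => n; rewrite muln1. Qed.

Lemma poly_bounded_id : poly_bounded id.
Proof. by exists 1, 1 => n; rewrite mul1n. Qed.

Lemma poly_bounded_add g h :
  poly_bounded g -> poly_bounded h -> poly_bounded (fun n => g n + h n).
Proof.
move=> [C [d Hg]] [C' [d' Hh]]; exists (C + C'), (d + d') => n.
rewrite mulnDl; apply: leq_add.
  by apply: leq_trans (Hg n) _; rewrite leq_mul2l leq_pexp2l ?leq_addr ?orbT.
apply: leq_trans (Hh n) _; rewrite leq_mul2l; apply/orP; right.
by rewrite expnD leq_pmull // expn_gt0.
Qed.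

Lemma poly_bounded_mul g h :
  poly_bounded g -> poly_bounded h -> poly_bounded (fun n => g n * h n).
Proof.
move=> [C [d Hg]] [C' [d' Hh]]; exists (C * C'), (d + d') => n.
by rewrite expnD mulnACA; apply: leq_mul.
Qed.

Lemma poly_bounded_comp g h :
  poly_bounded g -> poly_bounded h -> poly_bounded (fun n => g (h n)).
Proof.
move=> [C [d Hg]] Hh; have [C' [d' Hh']] : poly_bounded (fun n => C * (h n).+1 ^ d).
  apply: poly_bounded_mul; first exact: poly_bounded_const.
  elim: d {Hg} => [|d IH]; first exact: (poly_bounded_const 1).
  have [C' [d' H]] := poly_bounded_mul (poly_bounded_add (poly_bounded_const 1) Hh) IH.
  by exists C', d' => n; rewrite expnS; exact: H.
by exists C', d' => n; apply: leq_trans (Hg _) (Hh' n).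
Qed.

Lemma poly_bounded_peval p : poly_bounded (peval p).
Proof.
exists (\sum_(i < size p) nth 0 p i), (size p) => n.
rewrite /peval big_distrl /=; apply: leq_sum => i _.
rewrite leq_mul2l; apply/orP; right.
apply: (@leq_trans (n.+1 ^ i)); first by case: (nat_of_ord i) => // j; rewrite leq_exp2r.
by rewrite leq_pexp2l // ltnW.
Qed.

Lemma poly_bounded_le g : poly_bounded g -> exists p, forall n, g n <= peval p n.
Proof.
(* These are the coefficients of the binomial expansion of [C * (1 + n) ^ d]. *)
move=> [C [d Hg]]; exists (mkseq (fun i => C * 'C(d, i)) d.+1) => n.
apply: leq_trans (Hg n) _; rewrite -add1n expnDn big_distrr /peval size_mkseq.
apply: leq_sum => i _ /=; rewrite nth_mkseq //.
by rewrite exp1n mul1n mulnA.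
Qed.

(** * Encodings of instances *)

Definition hbits (ms : seq nat) : seq bool :=
  flatten [seq nseq m true ++ [:: false] | m <- ms].

Lemma parse_unary_nseq m s acc :
  parse_unary (nseq m true ++ false :: s) acc = Some (acc + m, s).
Proof. by elim: m acc => [|m IH] acc /=; rewrite ?addn0 // IH addSnnS. Qed.

Lemma parse_unaryP s acc k s' : parse_unary s acc = Some (k, s') ->
  exists2 m, k = acc + m & s = nseq m true ++ false :: s'.
Proof.
elim: s acc => [//|[] s IH] acc /=; last by case=> <- <-; exists 0; rewrite ?addn0.
by move/IH => [m -> ->]; exists m.+1; rewrite ?addSnnS.
Qed.

Lemma parse_header_hbits ms s : parse_header (size ms) (hbits ms ++ s) = Some (ms, s).
Proof. by elim: ms => [//|m ms IH] /=; rewrite -!catA parse_unary_nseq IH. Qed.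

Lemma parse_headerP n s ms s' : parse_header n s = Some (ms, s') ->
  size ms = n /\ s = hbits ms ++ s'.
Proof.
elim: n s ms s' => [|n IH] s ms s' /=; first by case=> <- <-.
case E: (parse_unary s 0) => [[m u]|//]; case E': (parse_header n u) => [[ms' v]|//].
case=> <- <- /=; have [<- uE] := IH _ _ _ E'.
by have [k -> ->] := parse_unaryP E; rewrite uE /hbits /= -!catA.
Qed.

Definition tbits (t : token) : seq bool :=
  match t with
  | TVar k => true :: nseq k true ++ [:: false]
  | TNot => [:: false; false]
  | TAnd => [:: false; true; false]
  | TOr => [:: false; true; true]
  end.

Lemma tokenize_nseq s j k :
  tokenize (nseq k true ++ false :: s) (Some j) = omap (cons (TVar (j + k))) (tokenize s None).
Proof. by elim: k j => [|k IH] j; rewrite ?addn0 // -addSnnS -IH. Qed.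

Lemma tokenize_tbits ts s :
  tokenize (flatten (map tbits ts) ++ s) None = omap (cat ts) (tokenize s None).
Proof.
elim: ts => [|t ts IH] /=; first by case: (tokenize s None).
case: t => [k|||] /=; rewrite -?catA ?tokenize_nseq IH; by case: (tokenize s None).
Qed.

Lemma tokenizeP s ts : tokenize s None = Some ts -> s = flatten (map tbits ts).
Proof.
(* [pre] puts back the ones of a variable token that is only partly read. The induction is on a
   bound for the size because a token may consume three bits at once. *)
pose pre cur := if cur is Some k then true :: nseq k true else [::].
suff H m : forall u us cur, size u <= m -> tokenize u cur = Some us ->
    pre cur ++ u = flatten (map tbits us) by exact: (H (size s) _ _ None).
elim: m => [|m IH] u us cur; first by case: u; case: cur => //= _ [<-].
case: cur => [k|]; case: u => [|[] u] //= le_u.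
- move/(IH u _ (Some k.+1) le_u) => /= <-; congr cons.
  by rewrite -[true :: u]cat1s catA -(nseqD k 1) addn1.
- case E: (tokenize u None) => [vs|] //= [<-] /=.
  by rewrite -catA -(IH u _ None).
- by case=> <-.
- by move/(IH u _ (Some 0) le_u) => /= <-.
- case: u le_u => [|[] u] //= le_u; last first.
    case E: (tokenize u None) => [vs|] //= [<-] /=.
    by rewrite -(IH u _ None) //; lia.
  case: u le_u => [|[] u] //= le_u; case E: (tokenize u None) => [vs|] //= [<-] /=;
    by rewrite -(IH u _ None) //; lia.
Qed.

Lemma rpn_cat ts us st : rpn (ts ++ us) st = obind (rpn us) (rpn ts st).
Proof.
by elim: ts st => [//|[k|||] ts IH] [|a [|b st]] /=; rewrite ?IH.
Qed.

(** A postfix formula is enlarged by appending tokens, so a query can be modified without being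
    parsed. *)
Lemma decode_cat n s us ms f g :
  decode n s = Some (ms, f) -> rpn us [:: f] = Some [:: g] -> fbound (sumn ms) g ->
  decode n (s ++ flatten (map tbits us)) = Some (ms, g).
Proof.
rewrite /decode; case E: (parse_header n s) => [[ms' s']|//].
have [<- ->] := parse_headerP E; rewrite -catA parse_header_hbits.
case: ifP => // _; case Et: (tokenize s' None) => [ts|//].
rewrite (tokenizeP Et) tokenize_tbits.
have -> : tokenize (flatten (map tbits us)) None = Some us.
  by rewrite -[flatten _]cats0 tokenize_tbits /= cats0.
rewrite /= rpn_cat; case: (rpn ts [::]) => [[|h [|? ?]]|] //=.
by case: ifP => // _ [<- <-] -> ->.
Qed.

(** * Quantified formulas *)

Lemma fbound_leq N N' f : N <= N' -> fbound N f -> fbound N' f.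
Proof.
move=> le; elim: f => [k|a IHa|a IHa b IHb|a IHa b IHb] //=.
- by move=> lt; apply: leq_trans lt le.
- by case/andP=> /IHa -> /IHb ->.
- by case/andP=> /IHa -> /IHb ->.
Qed.

Lemma feval_fbound N f e e' :
  fbound N f -> (forall i, i < N -> e i = e' i) -> feval e f = feval e' f.
Proof.
move=> + H; elim: f => [k|a IHa|a IHa b IHb|a IHa b IHb] /=; first exact: H.
- by move/IHa->.
- by case/andP=> /IHa -> /IHb ->.
- by case/andP=> /IHa -> /IHb ->.
Qed.

Lemma extend_ext e e' off m (t : m.-tuple bool) :
  e =1 e' -> extend e off t =1 extend e' off t.
Proof. by move=> H i; rewrite /extend H. Qed.

Lemma qval_ext q ms off e e' f g :
  e =1 e' -> (forall e1, feval e1 f = feval e1 g) -> qval q ms off e f = qval q ms off e' g.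
Proof.
move=> + Hfg; elim: ms q off e e' => [|m ms IH] q off e e' H /=.
  rewrite Hfg; elim: g {Hfg} => [k|a IHa|a IHa b IHb|a IHa b IHb] //=; by rewrite ?IHa ?IHb.
case: q; [apply: eq_existsb|apply: eq_forallb] => t; exact/IH/extend_ext.
Qed.

Lemma qval_not q ms off e f : qval q ms off e (FNot f) = ~~ qval (~~ q) ms off e f.
Proof.
elim: ms q off e => [//|m ms IH] [] off e /=.
  by rewrite negb_forall; apply: eq_existsb => t; rewrite IH.
by rewrite negb_exists; apply: eq_forallb => t; rewrite IH.
Qed.

(** The only play in an exhausted block is the empty tuple, so the turn passes to the opponent. *)
Lemma qval_nil q m off e f : qval q (0 :: m) off e f = qval (~~ q) m off e f.
Proof.
have H (t : 0.-tuple bool) : extend e off t =1 e.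
  by move=> i; rewrite /extend addn0; case: ifP => //; lia.
by case: q => /=; rewrite addn0; [apply/existsP/idP => [[t]|Hq]|apply/forallP/idP => [/(_ [tuple])|Hq t]];
  rewrite ?(qval_ext _ _ _ (H _) (fun=> erefl)) //; exists [tuple];
  rewrite (qval_ext _ _ _ (H _) (fun=> erefl)).
Qed.

Lemma qval_dummy q ms k off e f : fbound (off + sumn ms) f ->
  qval q (ms ++ nseq k 1) off e f = qval q ms off e f.
Proof.
elim: ms q off e => [|m ms IH] q off e /= Hf; last first.
  by case: q; [apply: eq_existsb|apply: eq_forallb] => t; apply: IH; rewrite -addnA.
rewrite addn0 in Hf.
(* The dummy blocks write only at positions from [off] on, which [f] does not read; hence the
   induction runs over all environments that agree with [e] below [off]. *)
suff H : forall off', off <= off' -> forall e', (forall i, i < off -> e' i = e i) ->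
    qval q (nseq k 1) off' e' f = feval e f by exact: H.
elim: k q => [|k IH] q off' le_off e' He /=; first exact: feval_fbound Hf _.
have Hk q' (t : 1.-tuple bool) : qval q' (nseq k 1) (off' + 1) (extend e' off' t) f = feval e f.
  apply: IH => [|i Hi]; first lia.
  by rewrite /extend ifF ?He //; lia.
case: q.
  by apply/existsP/idP => [[t]|H]; [rewrite Hk|exists [tuple false]; rewrite Hk].
by apply/forallP/idP => [/(_ [tuple false])|H t]; rewrite Hk.
Qed.

(** Once its first bit is fixed, an existential block is again an existential block, one bit
    shorter. This makes it possible to iterate an oracle that reveals one bit only. *)
Lemma qval_consP bs m ms b f :
  (exists t : m.+1.-tuple bool, nth false t 0 = b /\
     qval false ms (size bs + m.+1) (extend (nth false bs) (size bs) t) f) <->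
  qval true (m :: ms) (size bs).+1 (nth false (rcons bs b)) f.
Proof.
have H (t : m.-tuple bool) : extend (nth false bs) (size bs) (cons_tuple b t) =1
    extend (nth false (rcons bs b)) (size bs).+1 t.
  move=> i; rewrite /extend nth_rcons; have [lt|gt|<-] := ltngtP i (size bs).
  - by [].
  - rewrite addSnnS (nth_default _ (ltnW gt)) /=; case: ifP => // _.
    by have -> : i - size bs = (i - (size bs).+1).+1 by lia.
  - by rewrite subnn /= addnS ltnS leq_addr.
rewrite /= addSnnS; split=> [[t [tb Ht]]|/existsP[t Ht]].
  have Et : t = cons_tuple b [tuple of behead t].
    by apply/val_inj; case: t tb {Ht} => [[|a t]] //= _ ->.
  by apply/existsP; exists [tuple of behead t]; rewrite -(qval_ext _ _ _ (H _) (fun=> erefl)) -Et.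
by exists (cons_tuple b t); rewrite (qval_ext _ _ _ (H t) (fun=> erefl)).
Qed.

(** * Substituting bits for the first variables *)

(* Constants are not part of the formula language; they are kept as separate
   tokens and only expanded, into [x_0 \/ ~ x_0] or [x_0 /\ ~ x_0], in queries. *)
Inductive xtoken := XConst of bool | XTok of token.

Definition tsub (bs : seq bool) (t : token) : xtoken :=
  match t with
  | TVar k => if k < size bs then XConst (nth false bs k) else XTok (TVar (k - size bs))
  | _ => XTok t
  end.

Definition xsub (b : bool) (x : xtoken) : xtoken :=
  match x with
  | XTok (TVar 0) => XConst b
  | XTok (TVar k.+1) => XTok (TVar k)
  | _ => x
  end.

Definition xexpand (x : xtoken) : seq token :=
  match x with
  | XConst b => [:: TVar 0; TVar 0; TNot; if b then TOr else TAnd]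
  | XTok t => [:: t]
  end.

Lemma xsub_tsub b bs t : xsub b (tsub bs t) = tsub (rcons bs b) t.
Proof.
case: t => //= k; rewrite size_rcons nth_rcons; have [lt|gt|->] := ltngtP k (size bs).
- by rewrite ltnS ltnW.
- rewrite ltnNge gt /=.
  by have -> : k - size bs = (k - (size bs).+1).+1 by lia.
- by rewrite subnn ltnS leqnn.
Qed.

Fixpoint fsubst (bs : seq bool) (f : form) : form :=
  match f with
  | FVar k =>
    if k < size bs then (if nth false bs k then FOr else FAnd) (FVar 0) (FNot (FVar 0))
    else FVar (k - size bs)
  | FNot a => FNot (fsubst bs a)
  | FAnd a b => FAnd (fsubst bs a) (fsubst bs b)
  | FOr a b => FOr (fsubst bs a) (fsubst bs b)
  end.

(** A constant expands to tokens with the net effect of pushing one formula, exactly as a variable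
    token does. Substitution is therefore a pass over the tokens, and parsing fails after it if and
    only if it failed before. *)
Lemma rpn_fsubst bs ts st :
  rpn (flatten (map (xexpand \o tsub bs) ts)) (map (fsubst bs) st) =
  omap (map (fsubst bs)) (rpn ts st).
Proof.
elim: ts st => [//|[k|||] ts IH] st /=.
- by rewrite -IH /=; case: ifP => //= _; case: (nth _ _ _).
- by case: st => [|a st] //=; rewrite -IH.
- by case: st => [|a [|b st]] //=; rewrite -IH.
- by case: st => [|a [|b st]] //=; rewrite -IH.
Qed.

Definition prepend (bs : seq bool) (e : nat -> bool) : nat -> bool :=
  fun i => if i < size bs then nth false bs i else e (i - size bs).

Lemma feval_fsubst bs e f : feval e (fsubst bs f) = feval (prepend bs e) f.
Proof.
elim: f => [k|a IHa|a IHa b IHb|a IHa b IHb] /=; rewrite ?IHa ?IHb //.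
rewrite /prepend; case: ifP => // _.
by case: (nth _ _ _) => /=; case: (e 0).
Qed.

Lemma fbound_fsubst bs N f : 0 < N -> fbound (size bs + N) f -> fbound N (fsubst bs f).
Proof.
move=> N0; elim: f => [k|a IHa|a IHa b IHb|a IHa b IHb] //=.
- by case: ifP => H; [case: (nth _ _ _) => /=; rewrite N0|move=> /= ?; lia].
- by case/andP=> /IHa -> /IHb ->.
- by case/andP=> /IHa -> /IHb ->.
Qed.

Lemma extend_prepend bs e off m (t : m.-tuple bool) :
  extend (prepend bs e) (size bs + off) t =1 prepend bs (extend e off t).
Proof.
move=> i; rewrite /extend /prepend; case: (ltnP i (size bs)) => Hi.
  by rewrite ifF //; lia.
have -> : (size bs + off <= i) = (off <= i - size bs) by lia.
have -> : (i < size bs + off + m) = (i - size bs < off + m) by lia.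
by case: ifP => // _; congr nth; lia.
Qed.

Lemma qval_fsubst q ms off bs e f :
  qval q ms off e (fsubst bs f) = qval q ms (size bs + off) (prepend bs e) f.
Proof.
elim: ms q off e => [|m ms IH] q off e /=; first exact: feval_fsubst.
by case: q; [apply: eq_existsb|apply: eq_forallb] => t; rewrite IH addnA;
  apply: qval_ext => // i; rewrite extend_prepend.
Qed.

Lemma prepend_env0 bs : prepend bs env0 =1 nth false bs.
Proof. by move=> i; rewrite /prepend; case: ltnP => // H; rewrite nth_default. Qed.

Lemma fsubst_not bs k f : fsubst bs (iter k FNot f) = iter k FNot (fsubst bs f).
Proof. by elim: k => //= k ->. Qed.

Lemma fbound_not N k f : fbound N (iter k FNot f) = fbound N f.
Proof. by elim: k. Qed.

(* After [k] blocks have been played the current block is universal for odd [k]; negating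
   [k] times makes it existential again, and [k] blocks of one unused variable restore
   the number of blocks. *)
Definition query (bs : seq bool) (k : nat) (ms : seq nat) (ts : seq token) : seq bool :=
  hbits (ms ++ nseq k 1) ++
  flatten (map tbits (flatten (map xexpand (map (tsub bs) ts)) ++ nseq k TNot)).

Lemma decode_query n bs k ms ts f :
  size ms + k = n -> all (ltn 0) ms -> 0 < sumn ms ->
  rpn ts [::] = Some [:: f] -> fbound (size bs + sumn ms) f ->
  decode n (query bs k ms ts) = Some (ms ++ nseq k 1, fsubst bs (iter k FNot f)).
Proof.
move=> Hn Hms Hs Hts Hf; rewrite /decode /query.
have <- : size (ms ++ nseq k 1) = n by rewrite size_cat size_nseq.
rewrite parse_header_hbits all_cat all_nseq orbT andbT Hms.
rewrite -[flatten (map tbits _)]cats0 tokenize_tbits /= cats0 rpn_cat -map_comp.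
have /= -> := rpn_fsubst bs ts [::]; rewrite Hts /=.
have -> g : rpn (nseq k TNot) [:: g] = Some [:: iter k FNot g].
  by elim: k g {Hn} => [//|k IH] g /=; rewrite IH -iterS iterSr.
rewrite -fsubst_not fbound_fsubst //.
  by rewrite sumn_cat; lia.
by rewrite fbound_not sumn_cat addnA; apply: fbound_leq Hf; rewrite leq_addr.
Qed.

Lemma VAL_query n bs k m ms ts f b :
  (size ms).+1 + k = n -> all (ltn 0) ms ->
  rpn ts [::] = Some [:: f] -> fbound (size bs + (m.+1 + sumn ms)) f ->
  VAL n (query bs k (m.+1 :: ms) ts) b ->
  qval true (m :: ms) (size bs).+1 (nth false (rcons bs b)) (iter k FNot f) =
  qval true (m.+1 :: ms) (size bs) (nth false bs) (iter k FNot f).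
Proof.
move=> Hn Hms Hts Hf; rewrite /VAL (@decode_query n bs k (m.+1 :: ms) ts f) //.
set h := iter k FNot f.
have Hh : fbound (size bs + m.+1 + sumn ms) h by rewrite fbound_not -addnA.
(* The block [t] has the same value in the query, with its renumbered variables and dummy blocks, as
   in the original formula when played after [bs]. *)
have eb t : qval false (ms ++ nseq k 1) m.+1 (extend env0 0 t) (fsubst bs h) =
    qval false ms (size bs + m.+1) (extend (nth false bs) (size bs) t) h :> bool.
  rewrite qval_fsubst qval_dummy //; apply: qval_ext => // i.
  rewrite -extend_prepend addn0; exact/extend_ext/prepend_env0.
have eq0 : qval true (m.+1 :: ms ++ nseq k 1) 0 env0 (fsubst bs h) =
    qval true (m.+1 :: ms) (size bs) (nth false bs) h.
  by rewrite /=; apply: eq_existsb => t; rewrite add0n eb.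
rewrite /= in eq0; rewrite /= eq0; case: existsP => [_|Hno] Hb.
  apply: (proj1 (qval_consP bs m ms b h)); case: Hb => t [tb Ht].
  by exists t; rewrite -eb.
(* Here [b] is arbitrary, but a win after [b] would be a win from the position before it. *)
apply/negbTE/negP => /(proj2 (qval_consP bs m ms b h)) [t [_ Ht]]; apply: Hno.
by exists t.
Qed.

(** * Evaluation of constant formulas *)

(** [None] stands for stack errors and for leftover variables. When all [sumn ms] bits have been
    substituted, the leftover variables are exactly those out of range. *)
Fixpoint xeval (xs : seq xtoken) (st : seq bool) : option bool :=
  match xs, st with
  | [::], [:: v] => Some v
  | XConst b :: xs', _ => xeval xs' (b :: st)
  | XTok TNot :: xs', a :: st' => xeval xs' (~~ a :: st')
  | XTok TAnd :: xs', b :: a :: st' => xeval xs' (a && b :: st')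
  | XTok TOr :: xs', b :: a :: st' => xeval xs' (a || b :: st')
  | _, _ => None
  end.

Definition tbound (N : nat) (t : token) : bool := if t is TVar k then k < N else true.

(** Every token ends up inside some formula on the final stack, so the range of the variables can be
    checked token by token. *)
Lemma rpn_bound N ts st st' : rpn ts st = Some st' ->
  all (fbound N) st' = all (tbound N) ts && all (fbound N) st.
Proof.
elim: ts st => [|[k|||] ts IH] st /=; first by case=> ->.
- by move/IH => -> /=; rewrite andbA [(k < N) && _]andbC.
- by case: st => [|a st] // /IH ->.
- by case: st => [|b [|a st]] // /IH -> /=; rewrite [fbound N a && _]andbC -!andbA.
- by case: st => [|b [|a st]] // /IH -> /=; rewrite [fbound N a && _]andbC -!andbA.
Qed.

Lemma xeval_tsub bs ts st :
  xeval (map (tsub bs) ts) (map (feval (nth false bs)) st) =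
  if all (tbound (size bs)) ts then
    (if rpn ts st is Some [:: f] then Some (feval (nth false bs) f) else None)
  else None.
Proof.
elim: ts st => [|[k|||] ts IH] st /=.
- by case: st => [|a [|b st]].
- by case: ifP => //= _; rewrite -IH.
- by case: st => [|a st] /=; rewrite -?IH //; case: ifP.
- by case: st => [|a [|b st]] /=; rewrite -?IH //; case: ifP.
- by case: st => [|a [|b st]] /=; rewrite -?IH //; case: ifP.
Qed.

(** For a well-formed formula the game has preserved the value up to the parity of [k]; otherwise
    [xeval] fails just as [decode] does, and both sides are [false]. So nothing is assumed about the
    bits played on a malformed input. *)
Lemma SATfun_xeval n w ms s ts bs k :
  parse_header n w = Some (ms, s) -> all (ltn 0) ms -> tokenize s None = Some ts ->
  size bs = sumn ms ->
  (forall f, rpn ts [::] = Some [:: f] -> fbound (sumn ms) f ->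
     qval true ms 0 env0 f =
     odd k (+) qval true [::] (size bs) (nth false bs) (iter k FNot f)) ->
  SATfun n w = odflt false (xeval (map (tsub bs) ts) [::]).
Proof.
move=> Hh Hms Ht Hbs Hf; rewrite /SATfun /decode Hh Hms Ht.
have := xeval_tsub bs ts [::]; rewrite /= => ->; rewrite Hbs.
case E: (rpn ts [::]) => [st|]; last by case: ifP.
have := rpn_bound (sumn ms) E; rewrite andbT => <-.
case: st E => [|f [|g st]] //= E; try by case: ifP.
rewrite andbT; case: ifP => //= Hb; rewrite Hf //=.
(* The parity of [k] cancels the [k] negations. *)
by elim: k {Hf} => //= k; rewrite addbN addNb negbK.
Qed.

(** * Deciding SAT with the VAL oracle *)

(* The token [VAR k] is stored as [k.+1] copies of [LU] followed by [LV]. *)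
Inductive letter := LBit of bool | LU | LV | LC of bool | LN | LA | LO.

Definition letter_code (a : letter) : (bool + bool) + 'I_5 :=
  match a with
  | LBit b => inl (inl b) | LC b => inl (inr b)
  | LU => inr (@Ordinal 5 0 isT) | LV => inr (@Ordinal 5 1 isT)
  | LN => inr (@Ordinal 5 2 isT) | LA => inr (@Ordinal 5 3 isT) | LO => inr (@Ordinal 5 4 isT)
  end.
Definition letter_decode (c : (bool + bool) + 'I_5) : letter :=
  match c with
  | inl (inl b) => LBit b | inl (inr b) => LC b
  | inr i => nth LU [:: LU; LV; LN; LA; LO] i
  end.
Lemma letter_codeK : cancel letter_code letter_decode.
Proof. by case. Qed.
HB.instance Definition _ := Finite.copy letter (can_type letter_codeK).

(* [SL] and [SR] hold the tape of the simulated machine on either side of its head,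
   [SX] its query word, last bit on top. *)
Inductive stk := SL | SR | SX | SH | ST | SF.

Definition stk_code (a : stk) : 'I_6 :=
  match a with
  | SL => @Ordinal 6 0 isT | SR => @Ordinal 6 1 isT | SX => @Ordinal 6 2 isT
  | SH => @Ordinal 6 3 isT | ST => @Ordinal 6 4 isT | SF => @Ordinal 6 5 isT
  end.
Definition stk_decode (i : 'I_6) : stk := nth SL [:: SL; SR; SX; SH; ST; SF] i.
Lemma stk_codeK : cancel stk_code stk_decode.
Proof. by case. Qed.
HB.instance Definition _ := Finite.copy stk (can_type stk_codeK).

Section Programs.
Variables (G : finType).

Definition symbol : finType := (G + letter)%type.

Local Notation program := (prog stk symbol).
Local Notation lt := (@inr G letter).

Definition mk (l r x h t f : seq symbol) : store stk symbol :=
  [ffun i => match i with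
             | SL => l | SR => r | SX => x | SH => h | ST => t | SF => f
             end].

Lemma upd_mk l r x h t f s :
  (upd (mk l r x h t f) SL s = mk s r x h t f) *
  (upd (mk l r x h t f) SR s = mk l s x h t f) *
  (upd (mk l r x h t f) SX s = mk l r s h t f) *
  (upd (mk l r x h t f) SH s = mk l r x s t f) *
  (upd (mk l r x h t f) ST s = mk l r x h s f) *
  (upd (mk l r x h t f) SF s = mk l r x h t s).
Proof.
by do ![split]; apply/ffunP => j; rewrite !ffunE; case: eqP => [->|]; case: j.
Qed.

Lemma get_mk l r x h t f :
  (mk l r x h t f SL = l) * (mk l r x h t f SR = r) * (mk l r x h t f SX = x) *
  (mk l r x h t f SH = h) * (mk l r x h t f ST = t) * (mk l r x h t f SF = f).
Proof. by do ![split]; rewrite ffunE. Qed.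

Definition mkE := (upd_mk, get_mk).

Variable orc : promise.

Local Notation run := (run orc).

Fixpoint ppushes (i : stk) (l : seq symbol) : program unit :=
  if l is a :: l' then pbind (ppush i a) (fun _ => ppushes i l') else pskip tt.

Fixpoint pemits (l : seq bool) : program unit :=
  if l is b :: l' then pbind (pemit b) (fun _ => pemits l') else pskip tt.

Lemma upd_id (st : store stk symbol) i : upd st i (st i) = st.
Proof. by apply/ffunP => j; rewrite ffunE; case: eqP => [->|]. Qed.

Lemma upd_upd (st : store stk symbol) i s s' : upd (upd st i s) i s' = upd st i s'.
Proof. by apply/ffunP => j; rewrite !ffunE; case: eqP. Qed.

Lemma upd_get (st : store stk symbol) i j s : upd st i s j = if j == i then s else st j.
Proof. by rewrite ffunE. Qed.

Lemma run_pushes_seq (B : Type) i l (f : unit -> program B) t (st : store stk symbol) w P :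
  size l < t ->
  run (f tt) (t - (size l).+1) (upd st i (rev l ++ st i)) w P ->
  run (pbind (ppushes i l) f) t st w P.
Proof.
move=> Ht H; apply: (run_bind Ht); move: (t - _) H => u H.
elim: l st {Ht} H => [|a l IH] st H /=.
  by apply: run_skip; rewrite // -[st](upd_id _ i).
apply: run_push => //=; apply: (IH (upd st i (a :: st i))).
by move: H; rewrite upd_upd upd_get eqxx rev_cons cat_rcons.
Qed.

Lemma run_emits_seq (B : Type) l (f : unit -> program B) t (st : store stk symbol) w P :
  size l < t ->
  run (f tt) (t - (size l).+1) st (w ++ l) P ->
  run (pbind (pemits l) f) t st w P.
Proof.
move=> Ht H; apply: (run_bind Ht); move: (t - _) H => u H.
elim: l w {Ht} H => [|b l IH] w H /=; first by apply: run_skip; rewrite ?cats0 // in H *.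
by apply: run_emit => //=; apply: IH; rewrite -catA.
Qed.

(** * Finite-state transducers from one stack to another *)

Section Stream.
Variables (S : finType) (i j : stk).
Variables (nx : S -> symbol -> S) (out : S -> symbol -> seq symbol) (em : symbol -> seq bool).

Definition stream : S -> program S :=
  @ploop _ _ S S (fun s =>
    pbind (ppop i) (fun o =>
      if o is Some a then
        pbind (ppushes j (out s a)) (fun _ =>
        pbind (pemits (em a)) (fun _ =>
        pskip (inl (nx s a))))
      else pskip (inr s))).

Fixpoint souts (s : S) (l : seq symbol) : seq symbol :=
  if l is a :: l' then out s a ++ souts (nx s a) l' else [::].

Hypothesis ij : i != j.
Hypothesis bound : forall s a, size (out s a) + size (em a) <= 12.

(** A letter costs at most 12 steps of output and four more: the pop, the ends of the two output
    programs and the loop return. The remaining 2 are the pop that finds the stack empty and the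
    exit. *)
Lemma run_stream s (st : store stk symbol) w :
  run (stream s) (16 * size (st i) + 2) st w (fun s' st' w' =>
    [/\ s' = foldl nx s (st i),
        st' = upd (upd st i [::]) j (rev (souts s (st i)) ++ st j) &
        w' = w ++ flatten (map em (st i))]).
Proof.
have ji : (j == i) = false by rewrite eq_sym (negbTE ij).
move E : (st i) => l; elim: l s st w E => [|a l IH] s st w E.
  apply: (@run_loop _ _ _ _ _ _ 2) => //.
  apply: run_pop => //; rewrite E; apply: run_skip => //; split=> //; last by rewrite cats0.
  by apply/ffunP => k; rewrite !ffunE; case: (eqVneq k j) => // ->; rewrite ji.
have bd := bound s a.
apply: (@run_loop _ _ _ _ _ _ 16); first by rewrite /=; lia.
apply: run_pop => //; rewrite E; apply: run_pushes_seq; first lia.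
apply: run_emits_seq; first lia.
apply: run_skip; first lia.
set st2 := upd _ _ _; have := IH (nx s a) st2 (w ++ em a).
rewrite /st2 !upd_get ji (negbTE ij) eqxx => /(_ erefl).
apply: run_mono => [|_ st' w' [-> -> ->]]; first by rewrite /=; lia.
split=> //; last by rewrite /= catA.
rewrite /= rev_cat -catA.
by apply/ffunP => k; rewrite !ffunE; case: eqP => // _; case: eqP.
Qed.

Lemma run_stream_seq (B : Type) s (f : S -> program B) t (st : store stk symbol) w P :
  16 * size (st i) + 2 <= t ->
  run (f (foldl nx s (st i))) (t - (16 * size (st i) + 2))
    (upd (upd st i [::]) j (rev (souts s (st i)) ++ st j)) (w ++ flatten (map em (st i))) P ->
  run (pbind (stream s) f) t st w P.
Proof.
move=> le_t H; apply: (run_bind le_t); apply: run_mono (run_stream s st w) => //.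
by move=> s' st' w' [-> -> ->].
Qed.

End Stream.

(** The transfer reverses the stack, so contents are moved there and back; bits are emitted in the
    order read from the top. *)
Definition copy (i j : stk) (em : symbol -> seq bool) : program unit :=
  @stream unit i j (fun _ _ => tt) (fun _ a => [:: a]) em tt.

Lemma run_copy_seq (B : Type) i j em (f : unit -> program B) t (st : store stk symbol) w P :
  i != j -> (forall a, size (em a) <= 11) -> 16 * size (st i) + 2 <= t ->
  run (f tt) (t - (16 * size (st i) + 2))
    (upd (upd st i [::]) j (rev (st i) ++ st j)) (w ++ flatten (map em (st i))) P ->
  run (pbind (copy i j em) f) t st w P.
Proof.
move=> ij Hem le_t H; apply: run_stream_seq => //.
case: (foldl _ _ _); suff -> : souts (fun _ _ => tt) (fun _ a => [:: a]) tt (st i) = st i by [].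
by elim: (st i) => //= a l ->.
Qed.

Definition clear (i j : stk) : program unit :=
  @stream unit i j (fun _ _ => tt) (fun _ _ => [::]) (fun _ => [::]) tt.

Lemma run_clear_seq (B : Type) i j (f : unit -> program B) t (st : store stk symbol) w P :
  i != j -> 16 * size (st i) + 2 <= t ->
  run (f tt) (t - (16 * size (st i) + 2)) (upd st i [::]) w P ->
  run (pbind (clear i j) f) t st w P.
Proof.
move=> ij le_t H; apply: run_stream_seq => //.
have -> : flatten [seq [::] | _ <- st i] = [::] :> seq bool by elim: (st i).
have -> l : souts (S := unit) (fun _ _ => tt) (fun _ _ => [::]) tt l = [::] by elim: l.
case: (foldl _ _ _); rewrite cats0 /=; suff -> : upd (upd st i [::]) j (st j) = upd st i [::] by [].
by apply/ffunP => k; rewrite !ffunE; case: eqP => // ->; rewrite eq_sym (negbTE ij).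
Qed.

(** ** Parsing *)

Definition lbit (b : bool) : symbol := lt (LBit b).
Definition nobits (_ : symbol) : seq bool := [::].

(** The flag records whether a [1] has been seen, so that an empty block is rejected. *)
Definition parse_block : bool -> program bool :=
  @ploop _ _ bool bool (fun s =>
    pbind (ppop ST) (fun o =>
      match o with
      | Some (inr (LBit true)) => pbind (ppush SX (lbit true)) (fun _ => pskip (inl true))
      | Some (inr (LBit false)) => pbind (ppush SX (lbit false)) (fun _ => pskip (inr s))
      | _ => pskip (inr false)
      end)).

Lemma run_parse_block seen l r x h f s w :
  run (parse_block seen) (3 * size s + 2) (mk l r x h (map lbit s) f) w (fun b st' w' =>
    w' = w /\
    if parse_unary s 0 is Some (m, s') then
      b = seen || (0 < m) /\ st' = mk l r (lbit false :: nseq m (lbit true) ++ x) h (map lbit s') f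
    else b = false /\ exists x' t', st' = mk l r x' h t' f).
Proof.
elim: s seen x => [|[] s IH] seen x.
- apply: (@run_loop _ _ _ _ _ _ 2) => //; apply: run_pop => //.
  by rewrite !mkE /=; apply: run_skip => //; split=> //; split=> //; exists x, [::].
- apply: (@run_loop _ _ _ _ _ _ 3); first by rewrite /=; lia.
  apply: run_pop => //; rewrite !mkE /=; apply: run_push => //; rewrite !mkE /=.
  apply: run_skip => //; apply: run_mono (IH true _); first by lia.
  move=> b st' w' [-> H]; split=> //; move: H => /=.
  have -> : parse_unary s 1 = if parse_unary s 0 is Some (m, s') then Some (m.+1, s') else None.
    elim: (s) (0) => [|[] u IHu] a //=; exact: IHu.
  case: (parse_unary s 0) => [[m s']|//] [-> ->]; rewrite orbT; split=> //.
  by congr mk; congr cons; rewrite -cat_rcons -cats1 -(nseqD m 1) addn1.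
- apply: (@run_loop _ _ _ _ _ _ 3); first by rewrite /=; lia.
  apply: run_pop => //; rewrite !mkE /=; apply: run_push => //; rewrite !mkE /=.
  by apply: run_skip => //; split=> //=; rewrite orbF.
Qed.

Fixpoint parse_blocks (n : nat) : program bool :=
  if n is n'.+1 then
    pbind (parse_block false) (fun b => if b then parse_blocks n' else pskip false)
  else pskip true.

Lemma run_parse_blocks n l r x h f s w :
  run (parse_blocks n) (n.+1 * (3 * size s + 4)) (mk l r x h (map lbit s) f) w (fun b st' w' =>
    w' = w /\
    match parse_header n s with
    | Some (ms, s') =>
      if all (ltn 0) ms then
        b = true /\ st' = mk l r (rev (map lbit (hbits ms)) ++ x) h (map lbit s') f
      else b = false /\ exists x' t', st' = mk l r x' h t' f
    | None => b = false /\ exists x' t', st' = mk l r x' h t' f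
    end).
Proof.
elim: n s x => [|n IH] s x; first by apply: run_skip; [lia|].
apply: (run_bind (t1 := 3 * size s + 2)); first by rewrite mulSn; lia.
apply: run_mono (run_parse_block _ _ _ _ _ _ _ _) => // b st' w' [-> ] /=.
case E: (parse_unary s 0) => [[m s']|]; last first.
  by case=> -> junk; apply: run_skip; [rewrite [n.+2 * _]mulSn; lia|].
case=> /= -> ->; case: ltnP => Hm; last first.
  apply: run_skip; first by rewrite [n.+2 * _]mulSn; lia.
  have junk : exists x' t',
      mk l r (lbit false :: nseq m (lbit true) ++ x) h (map lbit s') f = mk l r x' h t' f.
    by eexists; eexists.
  by split=> //; case: (parse_header n s') => [[ms s'']|] //=; rewrite ltnNge Hm.
have Hs : size s = m + (size s').+1.
  by have [k -> ->] := parse_unaryP E; rewrite size_cat size_nseq.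
have := IH s' (lbit false :: nseq m (lbit true) ++ x).
apply: run_mono => [|b' st2 w2 [-> H]].
  have le : n.+1 * (3 * size s' + 4) <= n.+1 * (3 * size s + 4) by rewrite leq_mul2l; lia.
  by rewrite [n.+2 * _]mulSn; lia.
split=> //; case: (parse_header n s') H => [[ms s'']|//] /=.
rewrite Hm /=; case: ifP => // _ [-> ->]; split=> //; congr mk.
rewrite [hbits (m :: ms)]/hbits /= -/(hbits ms) !map_cat !rev_cat map_nseq -!catA.
have -> : rev (nseq m (lbit true)) = nseq m (lbit true).
  elim: (m) => // k IHk; by rewrite -[in LHS]addn1 nseqD rev_cat IHk.
by [].
Qed.

Definition tlet (t : token) : seq letter :=
  match t with
  | TVar k => nseq k.+1 LU ++ [:: LV]
  | TNot => [:: LN] | TAnd => [:: LA] | TOr => [:: LO]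
  end.

(* Scanner states: [None] between tokens, [Some (Some true)] inside a variable,
   [Some None] after [0], [Some (Some false)] after [01]. *)
Definition scan_step (s : option (option bool)) (b : bool) :
    option (option bool) * seq letter :=
  match s, b with
  | None, true | Some (Some true), true => (Some (Some true), [:: LU])
  | Some (Some true), false => (None, [:: LV])
  | None, false => (Some None, [::])
  | Some None, false => (None, [:: LN])
  | Some None, true => (Some (Some false), [::])
  | Some (Some false), false => (None, [:: LA])
  | Some (Some false), true => (None, [:: LO])
  end.

Definition scan_next s (a : symbol) := if a is inr (LBit b) then (scan_step s b).1 else s.
Definition scan_out s (a : symbol) : seq symbol :=
  if a is inr (LBit b) then map lt (scan_step s b).2 else [::].

Definition scan : program bool :=
  pbind (stream ST SF scan_next scan_out nobits None) (fun s => pskip (s == None)).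

Lemma scanP s :
  if tokenize s None is Some ts then
    foldl scan_next None (map lbit s) = None /\
    souts scan_next scan_out None (map lbit s) = map lt (flatten (map tlet ts))
  else foldl scan_next None (map lbit s) <> None.
Proof.
pose state (cur : option nat) := if cur is Some k then Some (Some true) else None.
pose pre (cur : option nat) := if cur is Some k then map lt (nseq k.+1 LU) else [::].
suff H m : forall u cur, size u <= m ->
    if tokenize u cur is Some us then
      foldl scan_next (state cur) (map lbit u) = None /\
      pre cur ++ souts scan_next scan_out (state cur) (map lbit u) =
      map lt (flatten (map tlet us))
    else foldl scan_next (state cur) (map lbit u) <> None.
  exact: (H (size s) s None).
elim: m => [|m IH] u cur; first by case: u; case: cur.
case: cur => [k|]; case: u => [|[] u] //= le_u.
- have := IH u (Some k.+1) le_u; case: (tokenize _ _) => //= us [-> <-]; split=> //.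
  by congr cons; elim: (k) => //= k' ->.
- have := IH u None le_u; case: (tokenize _ _) => //= us [-> E]; split=> //.
  by rewrite !map_cat -E -catA.
- by have := IH u (Some 0) le_u; case: (tokenize _ _).
- case: u le_u => [|[] u] //= le_u; last first.
    by have := IH u None (ltnW le_u); case: (tokenize _ _) => //= us [-> <-].
  have le_u' : size u <= m.+1 by lia.
  case: u le_u le_u' => [|[] u] //= le_u le_u'; have := IH u None (ltnW (ltnW le_u));
    by case: (tokenize _ _) => //= us [-> <-].
Qed.

Lemma run_scan l r x h s w :
  run scan (16 * size s + 3) (mk l r x h (map lbit s) [::]) w (fun b st' w' =>
    w' = w /\
    if tokenize s None is Some ts then
      b = true /\ st' = mk l r x h [::] (rev (map lt (flatten (map tlet ts))))
    else b = false /\ exists f', st' = mk l r x h [::] f').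
Proof.
apply: run_stream_seq => //.
- by case=> [[[]|]|] [g|[[]|||[]|||]].
- by rewrite get_mk size_map; lia.
rewrite !mkE size_map /= cats0.
have -> : flatten [seq nobits i | i <- map lbit s] = [::] by elim: (s).
apply: run_skip; first lia.
split; first by rewrite cats0.
have := scanP s; case: (tokenize s None) => [ts [-> ->]|] //.
by case: (foldl _ _ _) => // a _; split=> //; eexists.
Qed.

(** ** Playing the blocks *)

Definition xlet (x : xtoken) : seq letter :=
  match x with
  | XConst b => [:: LC b]
  | XTok t => tlet t
  end.

Definition xlets (xs : seq xtoken) : seq symbol := map lt (flatten (map xlet xs)).

(** The nine bits of [LC b] are the tokens [VAR 0], [VAR 0], [NOT] and [01b]; the last one is [OR]
    for a true [b] and [AND] for a false one. The translation is letter by letter, so a query is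
    emitted in the course of a copy. *)
Definition bits_of (a : symbol) : seq bool :=
  match a with
  | inr (LBit b) => [:: b]
  | inr LU => [:: true]
  | inr LV => [:: false]
  | inr (LC b) => [:: true; false; true; false; false; false; false; true; b]
  | inr LN => [:: false; false]
  | inr LA => [:: false; true; false]
  | inr LO => [:: false; true; true]
  | inl _ => [::]
  end.

Lemma bits_of_xlets xs :
  flatten (map bits_of (xlets xs)) = flatten (map tbits (flatten (map xexpand xs))).
Proof.
rewrite /xlets; elim: xs => //= x xs IH.
rewrite !map_cat !flatten_cat IH; congr cat.
case: x => [[]|[k|||]] //=; rewrite !cats0; congr cons.
by elim: k => //= k ->.
Qed.

Lemma bits_of_lbit s : flatten (map bits_of (map lbit s)) = s.
Proof. by elim: s => //= b s ->. Qed.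

(* Substitution of [b] for variable 0 drops one [LU] of every variable; the state is
   [None] between tokens and [Some c] inside a variable, with [c] set once a second
   [LU] has been seen. *)
Definition sub_next (s : option bool) (a : symbol) : option bool :=
  match a, s with
  | inr LU, None => Some false
  | inr LU, Some _ => Some true
  | _, _ => None
  end.
Definition sub_out (b : bool) (s : option bool) (a : symbol) : seq symbol :=
  match a, s with
  | inr LU, None => [::]
  | inr LV, Some false => [:: lt (LC b)]
  | _, _ => [:: a]
  end.

Lemma souts_sub b xs : souts sub_next (sub_out b) None (xlets xs) = xlets (map (xsub b) xs).
Proof.
rewrite /xlets; elim: xs => //= x xs IH; rewrite !map_cat -IH.
case: x => [c|[[|k]|||]] //=; congr cons.
by elim: k => //= k ->.
Qed.

(** The caller has already popped a [1] from the header of the current block. The first emission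
    restores it in the query only, so the stack afterwards describes the block with one bit less. *)
Definition ask_bit (k : nat) : program bool :=
  pbind (pemit true) (fun _ =>
  pbind (copy SH SX bits_of) (fun _ =>
  pbind (pemits (hbits (nseq k 1))) (fun _ =>
  pbind (copy SX SH nobits) (fun _ =>
  pbind (copy ST SF bits_of) (fun _ =>
  pbind (pemits (flatten (map tbits (nseq k TNot)))) (fun _ =>
  pbind pask (fun y =>
  pbind (copy SF ST nobits) (fun _ =>
  pbind (stream ST SF sub_next (sub_out y) nobits None) (fun _ =>
  pbind (copy SF ST nobits) (fun _ =>
  pskip y)))))))))).

Definition state_store l r bs ms ts :=
  mk l r [::] (map lbit (hbits ms)) (xlets (map (tsub bs) ts)) [::].

Lemma hbits_cat ms ms' : hbits (ms ++ ms') = hbits ms ++ hbits ms'.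
Proof. by rewrite /hbits map_cat flatten_cat. Qed.

Lemma size_hbits ms : size (hbits ms) = sumn ms + size ms.
Proof. by elim: ms => //= m ms IH; rewrite !size_cat size_nseq /= -/(hbits ms) IH; lia. Qed.

(** A substituted constant is a single letter, so the stored formula never outgrows the input,
    however many bits are played. Expanded constants would contain [x_0] again and grow with every
    substitution. *)
Lemma size_xlets_tsub bs ts :
  size (xlets (map (tsub bs) ts)) <= size (flatten (map tbits ts)).
Proof.
rewrite /xlets size_map; elim: ts => //= t ts IH; rewrite !size_cat; apply: leq_add => //.
case: t => //= k; case: ifP => _ //=; rewrite !size_cat !size_nseq //=; lia.
Qed.

Lemma nobits_nil (s : seq symbol) : flatten (map nobits s) = [::].
Proof. by elim: s. Qed.

(** Six passes over stacks of height at most [L] give [96 * L]; the dummy blocks and the negations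
    contribute [2 * k] bits each. *)
Lemma run_ask_bit k l r bs m ms ts L :
  size (hbits (m.+1 :: ms)) <= L -> size (flatten (map tbits ts)) <= L ->
  run (ask_bit k) (96 * L + 4 * k + 30) (state_store l r bs (m :: ms) ts) [::]
    (fun y st' w' => [/\ orc (query bs k (m.+1 :: ms) ts) y, w' = [::] &
       st' = state_store l r (rcons bs y) (m :: ms) ts]).
Proof.
move=> HL HT.
have Hh : size (hbits (m :: ms)) <= L.
  by apply: leq_trans HL; rewrite !size_hbits /=; lia.
have Ht bs' := leq_trans (size_xlets_tsub bs' ts) HT.
have Hd : size (hbits (nseq k 1)) = 2 * k by rewrite size_hbits sumn_nseq size_nseq; lia.
have Hn : size (flatten (map tbits (nseq k TNot))) = 2 * k.
  by elim: (k) => //= j /eqP; rewrite -/(nseq j TNot); lia.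
have Hb a : size (bits_of a) <= 11 by case: a => [g|[]].
rewrite /ask_bit /state_store.
set H := map lbit (hbits (m :: ms)).
have HH : size H <= L by rewrite size_map.
apply: run_emit; first lia.
apply: run_copy_seq => //; rewrite !mkE; first lia.
apply: run_emits_seq; rewrite ?Hd; first lia.
apply: run_copy_seq => //; rewrite !mkE cats0 ?size_rev; first lia.
rewrite cats0 revK nobits_nil.
have Ht0 := Ht bs; apply: (run_less (t := 64 * L + 2 * k + 20)); first lia.
apply: run_copy_seq => //; rewrite !mkE; first lia.
apply: run_emits_seq; rewrite ?Hn; first lia.
apply: run_ask; first lia.
move=> y Hy; apply: (run_less (t := 48 * L + 10)); first lia.
apply: run_copy_seq => //; rewrite !mkE ?cats0 ?size_rev; first lia.
rewrite revK; apply: (run_less (t := 32 * L + 8)); first lia.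
apply: run_stream_seq => //; rewrite ?mkE; [|lia|].
  by case=> [[]|] [g|[[]|||[]|||]].
have Ht1 := Ht (rcons bs y).
have Es : souts sub_next (sub_out y) None (xlets (map (tsub bs) ts)) =
    xlets (map (tsub (rcons bs y)) ts).
  by rewrite souts_sub -map_comp; congr xlets; apply: eq_map => t; exact: xsub_tsub.
rewrite Es !nobits_nil cats0; apply: (run_less (t := 16 * L + 6)); first lia.
apply: run_copy_seq => //; rewrite !mkE ?size_rev; first lia.
apply: run_skip; first lia.
split; rewrite ?nobits_nil ?cats0 ?revK //.
move: Hy; congr orc; rewrite /query bits_of_xlets bits_of_lbit map_cat flatten_cat hbits_cat.
by rewrite /= !catA !cats0.
Qed.

Definition play_block (k : nat) : unit -> program unit :=
  @ploop _ _ unit unit (fun _ =>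
    pbind (ppop SH) (fun o =>
      match o with
      | Some (inr (LBit true)) => pbind (ask_bit k) (fun _ => pskip (inl tt))
      | _ => pskip (inr tt)
      end)).

Fixpoint play (r k : nat) : program unit :=
  if r is r'.+1 then pbind (play_block k tt) (fun _ => play r' k.+1) else pskip tt.

Section Play.
Variables (n : nat) (ms0 : seq nat) (ts : seq token) (L : nat).
Hypothesis orc_VAL : forall w y, orc w y -> VAL n w y.
Hypothesis tsL : size (flatten (map tbits ts)) <= L.

(* The value of the game is unchanged by the moves read off the answers: a winning
   position of the player to move has a winning move, found by the oracle, and from a
   losing position every move loses. *)
Definition play_inv (bs : seq bool) (k : nat) (ms : seq nat) : Prop :=
  [/\ size ms + k = n, all (ltn 0) (behead ms), size bs + sumn ms = sumn ms0 &
      forall f, rpn ts [::] = Some [:: f] -> fbound (sumn ms0) f ->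
        qval true ms0 0 env0 f =
        odd k (+) qval true ms (size bs) (nth false bs) (iter k FNot f)].

Lemma play_inv_move bs k m ms y :
  play_inv bs k (m.+1 :: ms) -> orc (query bs k (m.+1 :: ms) ts) y ->
  play_inv (rcons bs y) k (m :: ms).
Proof.
move=> [Hn Hms Hs Hf] /orc_VAL Hy; split=> //; first by rewrite size_rcons -Hs /= addSnnS.
move=> f Hts Hb; rewrite (Hf f Hts Hb) size_rcons (VAL_query _ _ Hts _ Hy) //.
by rewrite -[X in fbound X]Hs in Hb.
Qed.

Lemma play_inv_block bs k ms :
  all (ltn 0) ms -> play_inv bs k (0 :: ms) -> play_inv bs k.+1 ms.
Proof.
move=> Hms [Hn _ Hs Hf]; split=> //; first by rewrite -Hn /= addnS.
  by case: (ms) Hms => //= m ms' /andP[].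
move=> f Hts Hb; rewrite (Hf f Hts Hb) qval_nil /= qval_not /=.
by rewrite addbN addNb negbK.
Qed.

Local Notation U := (96 * L + 4 * n + 40).

Lemma run_play_block l r k m ms bs :
  size (hbits (m :: ms)) <= L -> play_inv bs k (m :: ms) ->
  run (play_block k tt) (m.+1 * U) (state_store l r bs (m :: ms) ts) [::] (fun _ st' w' =>
    w' = [::] /\ exists2 bs', st' = state_store l r bs' ms ts & play_inv bs' k (0 :: ms)).
Proof.
elim: m bs => [|m IH] bs HL Hinv.
  apply: (run_loop (t1 := 2)); first lia.
  rewrite /state_store; apply: run_pop => //; rewrite !mkE /=; apply: run_skip => //.
  by split=> //; exists bs.
have kn : k <= n by case: Hinv => <- _ _ _; rewrite leq_addl.
apply: (run_loop (t1 := U)); first by rewrite mulSn leq_addr.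
rewrite mulSn addKn /state_store; apply: run_pop; first lia.
rewrite !mkE /= -/(state_store l r bs (m :: ms) ts).
have := run_ask_bit k l r bs HL tsL.
set T := 96 * L + 4 * k + 30 => Hask.
apply: (run_bind (t1 := T)); first by rewrite /T; lia.
apply: run_mono Hask => // y st' w' [Hy -> ->].
apply: run_skip; first by rewrite /T; lia.
apply: IH; last exact: play_inv_move Hy.
by apply: leq_trans HL; rewrite !size_hbits /=; lia.
Qed.

(** A block of [m] bits has [m.+1] header bits, which pay for its [m] queries and for its end; the
    number of rounds is thus the length of the header. *)
Lemma run_play l r k ms bs :
  size (hbits ms) <= L -> play_inv bs k ms -> all (ltn 0) ms ->
  run (play (size ms) k) (size (hbits ms) * U + 1) (state_store l r bs ms ts) [::]
    (fun _ st' w' =>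
      w' = [::] /\ exists bs' k', st' = state_store l r bs' [::] ts /\ play_inv bs' k' [::]).
Proof.
elim: ms k bs => [|m ms IH] k bs HL Hinv Hms.
  by apply: run_skip; rewrite ?addn1 //; split=> //; exists bs, k.
have E : size (hbits (m :: ms)) * U + 1 = m.+1 * U + (size (hbits ms) * U + 1).
  by rewrite !size_hbits /= addnA -mulnDl; congr (_ * _ + _); lia.
rewrite E; apply: (run_bind (t1 := m.+1 * U)); first exact: leq_addr.
rewrite addKn; apply: run_mono (run_play_block l r HL Hinv) => // _ st' w' [-> [bs' -> Hinv']].
case/andP: Hms => _ Hms; apply: IH => //; last exact: play_inv_block.
by apply: leq_trans HL; rewrite !size_hbits /=; lia.
Qed.

End Play.

(** ** Evaluating the remaining constants *)

(** [SX] is the evaluation stack. A surviving [LU] or [LV] gives [false], as does a missing operand;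
    at the end the second pop checks that exactly one value was left. *)
Definition eval_rpn : unit -> program bool :=
  @ploop _ _ unit bool (fun _ =>
    pbind (ppop ST) (fun o =>
      match o with
      | None =>
        pbind (ppop SX) (fun a =>
        pbind (ppop SX) (fun b =>
        pskip (inr (match a, b with Some (inr (LC v)), None => v | _, _ => false end))))
      | Some (inr (LC b)) => pbind (ppush SX (lt (LC b))) (fun _ => pskip (inl tt))
      | Some (inr LN) =>
        pbind (ppop SX) (fun a =>
        match a with
        | Some (inr (LC v)) => pbind (ppush SX (lt (LC (~~ v)))) (fun _ => pskip (inl tt))
        | _ => pskip (inr false)
        end)
      | Some (inr (LA as op)) | Some (inr (LO as op)) =>
        pbind (ppop SX) (fun b =>
        pbind (ppop SX) (fun a =>
        match a, b with
        | Some (inr (LC v)), Some (inr (LC u)) =>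
          pbind (ppush SX (lt (LC (if op is LA then v && u else v || u))))
            (fun _ => pskip (inl tt))
        | _, _ => pskip (inr false)
        end))
      | _ => pskip (inr false)
      end)).

Lemma run_eval_rpn l r st h xs f w :
  run (eval_rpn tt) (6 * size xs + 6)
    (mk l r (map (fun b => lt (LC b)) st) h (xlets xs) f) w (fun b st' w' =>
    [/\ b = odflt false (xeval xs st), w' = w &
        exists x' h' t' f', st' = mk l r x' h' t' f']).
Proof.
have junk a b c d : exists x' h' t' f', mk l r a b c d = mk l r x' h' t' f'.
  by exists a, b, c, d.
elim: xs st => [|x xs IH] st.
  apply: (run_loop (t1 := 6)) => //; apply: run_pop => //; rewrite !mkE /=.
  apply: run_pop => //; rewrite !mkE; apply: run_pop => //; rewrite !mkE.
  by apply: run_skip => //; split=> //; case: st => [|a [|b st]].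
apply: (run_loop (t1 := 6)); first by rewrite /=; lia.
have -> : 6 * size (x :: xs) + 6 - 6 = 6 * size xs + 6 by rewrite /=; lia.
apply: run_pop => //; rewrite !mkE.
case: x => [b|[[|k]|||]].
- by apply: run_push => //; rewrite !mkE; apply: run_skip => //; apply: (IH (b :: st)).
- by apply: run_skip.
- by apply: run_skip.
- apply: run_pop => //; rewrite !mkE; case: st => [|a st]; first exact: run_skip.
  by apply: run_push => //; rewrite !mkE; apply: run_skip => //; apply: (IH (~~ a :: st)).
- apply: run_pop => //; rewrite !mkE; apply: run_pop => //; rewrite !mkE.
  case: st => [|b [|a st]]; try exact: run_skip.
  by apply: run_push => //; rewrite !mkE; apply: run_skip => //; apply: (IH (a && b :: st)).
- apply: run_pop => //; rewrite !mkE; apply: run_pop => //; rewrite !mkE.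
  case: st => [|b [|a st]]; try exact: run_skip.
  by apply: run_push => //; rewrite !mkE; apply: run_skip => //; apply: (IH (a || b :: st)).
Qed.

(** ** The decision procedure *)

Definition decide_core (n : nat) : program bool :=
  pbind (copy SX ST nobits) (fun _ =>
  pbind (parse_blocks n) (fun b =>
  if b then
    pbind scan (fun b' =>
    if b' then
      pbind (copy SX SH nobits) (fun _ =>
      pbind (copy SF ST nobits) (fun _ =>
      pbind (play n 0) (fun _ =>
      eval_rpn tt)))
    else pskip false)
  else pskip false)).

Definition core_time (n L : nat) : nat :=
  (16 * L + 2) + n.+1 * (3 * L + 4) + (16 * L + 3) + 2 * (16 * L + 2) +
  (L * (96 * L + 4 * n + 40) + 1) + (6 * L + 6).

Lemma run_decide_core n L l r q :
  (forall w y, orc w y -> VAL n w y) -> size q <= L ->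
  run (decide_core n) (core_time n L) (mk l r (map lbit (rev q)) [::] [::] [::]) [::]
    (fun b st' w' => [/\ b = SATfun n q, w' = [::] &
       exists x' h' t' f', st' = mk l r x' h' t' f']).
Proof.
move=> Horc HL; rewrite /core_time.
set t2 := n.+1 * _; set t3 := L * _ + 1.
apply: run_copy_seq => //; rewrite !mkE ?size_map ?size_rev; first lia.
rewrite cats0 -map_rev revK nobits_nil.
apply: (run_less (t := t2 + (16 * L + 3) + 2 * (16 * L + 2) + t3 + (6 * L + 6))); first lia.
apply: (run_bind (t1 := n.+1 * (3 * size q + 4))).
  by apply: (@leq_trans t2); [rewrite leq_mul2l; lia|lia].
apply: run_mono (run_parse_blocks n l r [::] [::] [::] q [::]) => // b st' w' [-> H].
apply: (run_less (t := (16 * L + 3) + 2 * (16 * L + 2) + t3 + (6 * L + 6))).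
  have : n.+1 * (3 * size q + 4) <= t2 by rewrite leq_mul2l; lia.
  by lia.
have fail : SATfun n q = false ->
    (b = false /\ exists x' t', st' = mk l r x' [::] t' [::]) ->
    run (if b then pbind scan (fun b' => if b' then
      pbind (copy SX SH nobits) (fun _ =>
      pbind (copy SF ST nobits) (fun _ =>
      pbind (play n 0) (fun _ =>
      eval_rpn tt))) else pskip false) else pskip false)
      (16 * L + 3 + 2 * (16 * L + 2) + t3 + (6 * L + 6)) st' [::]
    (fun b st' w' => [/\ b = SATfun n q, w' = [::] &
       exists x' h' t' f', st' = mk l r x' h' t' f']).
  move=> -> [-> [x' [t' ->]]]; apply: run_skip; first lia.
  by split=> //; eexists; eexists; eexists; eexists.
case Eh: (parse_header n q) H => [[ms s]|] H; last first.
  by apply: fail H; rewrite /SATfun /decode Eh.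
case Ems: (all (ltn 0) ms) H => H; last first.
  by apply: fail H; rewrite /SATfun /decode Eh Ems.
case: H => -> -> {fail}.
have [Hsz Eq] := parse_headerP Eh.
have Hq : size (hbits ms) + size s <= L by rewrite -size_cat -Eq.
apply: (run_bind (t1 := 16 * size s + 3)); first lia.
rewrite cats0; apply: run_mono (run_scan _ _ _ _ _ _) => // b' st2 w2 [-> H].
apply: (run_less (t := 2 * (16 * L + 2) + t3 + (6 * L + 6))); first lia.
case Et: (tokenize s None) H => [ts|] H; last first.
  case: H => -> [f' ->]; apply: run_skip; first lia.
  split=> //; first by rewrite /SATfun /decode Eh Ems Et.
  by eexists; eexists; eexists; eexists.
case: H => -> ->.
have Es := tokenizeP Et.
have Hts : size (flatten (map tbits ts)) <= L by rewrite -Es; lia.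
have HT : xlets (map (tsub [::]) ts) = map lt (flatten (map tlet ts)).
  rewrite /xlets; congr map; congr flatten; rewrite -map_comp; apply: eq_map => t.
  by case: t => [k|||] //=; rewrite subn0.
have HTs := leq_trans (size_xlets_tsub [::] ts) Hts.
rewrite HT in HTs.
apply: run_copy_seq => //; rewrite !mkE ?size_rev ?size_map; first lia.
rewrite cats0 revK nobits_nil.
apply: (run_less (t := 16 * L + 2 + t3 + (6 * L + 6))); first lia.
apply: run_copy_seq => //; rewrite !mkE ?size_rev; first lia.
rewrite cats0 revK nobits_nil -HT -[mk _ _ _ _ _ _]/(state_store l r [::] ms ts).
rewrite -HT in HTs; apply: (run_less (t := t3 + (6 * L + 6))); first lia.
apply: (run_bind (t1 := t3)); first lia.
rewrite addKn.
have Hinv : play_inv n ms ts [::] 0 ms.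
  split=> //; first by rewrite addn0.
    by case: (ms) Ems => //= m ms' /andP[].
  by move=> f _ _; apply: qval_ext => // i; rewrite nth_nil.
have := run_play Horc Hts l r (_ : size (hbits ms) <= L) Hinv Ems.
rewrite Hsz => /(_ ltac:(lia)); apply: run_mono.
  by rewrite /t3 leq_add2r leq_mul2r; apply/orP; right; lia.
move=> _ st3 w3 [-> [bs [k [-> [Hk _ Hbs Hval]]]]].
rewrite addn0 in Hbs.
have -> : state_store l r bs [::] ts =
    mk l r (map (fun b => lt (LC b)) [::]) [::] (xlets (map (tsub bs) ts)) [::] by [].
apply: run_mono (run_eval_rpn _ _ _ _ _ _ _) => [|c st4 w4 [-> -> H]].
  rewrite size_map; apply: leq_add => //; rewrite leq_mul2l /=.
  apply: leq_trans Hts; elim: (ts) => //= t ts' IH; rewrite size_cat.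
  by case: t => [j|||] /=; lia.
split=> //; symmetry; exact: (SATfun_xeval Eh Ems Et Hbs Hval).
Qed.

(** The simulation calls this program repeatedly and needs the scratch stacks empty each time. A
    rejected input leaves unspecified contents, whose height [run_size] bounds by the input size
    plus the running time. *)
Definition decide (n : nat) : program bool :=
  pbind (decide_core n) (fun b =>
  pbind (clear SX SL) (fun _ =>
  pbind (clear SH SL) (fun _ =>
  pbind (clear ST SL) (fun _ =>
  pbind (clear SF SL) (fun _ =>
  pskip b))))).

Definition decide_time (n L : nat) : nat := core_time n L + 64 * (L + core_time n L) + 20.

Lemma poly_bounded_decide_time n : poly_bounded (decide_time n).
Proof.
have H : poly_bounded (core_time n).
  by do ?[exact: poly_bounded_const|exact: poly_bounded_id
         |apply: poly_bounded_add|apply: poly_bounded_mul].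
by do ?[exact: poly_bounded_const|exact: poly_bounded_id|exact: H
       |apply: poly_bounded_add|apply: poly_bounded_mul].
Qed.

Lemma run_decide n L l r q :
  (forall w y, orc w y -> VAL n w y) -> size q <= L ->
  run (decide n) (decide_time n L) (mk l r (map lbit (rev q)) [::] [::] [::]) [::]
    (fun b st' w' => [/\ b = SATfun n q, w' = [::] & st' = mk l r [::] [::] [::] [::]]).
Proof.
move=> Horc HL; rewrite /decide_time.
apply: (run_bind (t1 := core_time n L)); first lia.
apply: run_mono (run_size (run_decide_core l r Horc HL)) => // b st' w'.
set C := core_time n L; case=> [[-> -> [x [h [t [f ->]]]]] Hs].
have Hx : size x <= L + C.
  by have := Hs SX; rewrite !mkE size_map size_rev => Hx; apply: leq_trans Hx _; rewrite leq_add2r.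
have Hh : size h <= L + C by have := Hs SH; rewrite !mkE => Hh; apply: leq_trans Hh _; rewrite leq_add2r.
have Ht : size t <= L + C by have := Hs ST; rewrite !mkE => Ht; apply: leq_trans Ht _; rewrite leq_add2r.
have Hf : size f <= L + C by have := Hs SF; rewrite !mkE => Hf; apply: leq_trans Hf _; rewrite leq_add2r.
move: (L + C) Hx Hh Ht Hf => B Hx Hh Ht Hf.
apply: (run_less (t := 64 * B + 20)); first lia.
apply: run_clear_seq => //; rewrite !mkE; first lia.
apply: (run_less (t := 48 * B + 15)); first lia.
apply: run_clear_seq => //; rewrite !mkE; first lia.
apply: (run_less (t := 32 * B + 10)); first lia.
apply: run_clear_seq => //; rewrite !mkE; first lia.
apply: (run_less (t := 16 * B + 5)); first lia.
apply: run_clear_seq => //; rewrite !mkE; first lia.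
by apply: run_skip => //; lia.
Qed.

(** ** Answering a VAL query with the SAT oracle *)

Lemma decodeP n s ms f : decode n s = Some (ms, f) -> all (ltn 0) ms && fbound (sumn ms) f.
Proof.
rewrite /decode; case: (parse_header n s) => [[ms' s']|//]; case: ifP => // Hms.
case: (tokenize s' None) => [ts|//]; case: (rpn ts [::]) => [[|g [|? ?]]|] //.
by case: ifP => // Hg [<- <-]; rewrite Hms.
Qed.

(** Variable 0 is fixed once [off] is positive, so it factors out of all remaining quantifiers; as
    these range over nonempty sets, a false factor makes the whole value false. *)
Lemma qval_and_var0 q ms off e f : 0 < off ->
  qval q ms off e (FAnd f (FVar 0)) = e 0 && qval q ms off e f.
Proof.
elim: ms q off e => [|m ms IH] q off e Hoff /=; first by rewrite andbC.
have E q' (t : m.-tuple bool) : qval q' ms (off + m) (extend e off t) (FAnd f (FVar 0)) =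
    e 0 && qval q' ms (off + m) (extend e off t) f.
  by rewrite IH ?addn_gt0 ?Hoff // /extend leqNgt Hoff.
case: q; first under eq_existsb => t do rewrite E.
  by case: (e 0) => //; apply/existsP => -[].
under eq_forallb => t do rewrite E.
by case: (e 0) => //; apply/forallP => /(_ [tuple of nseq m false]).
Qed.

(** Only well-formed satisfiable [q] constrain the answer. For these the appended tokens conjoin
    [x_0], which is the first bit of the first block because that block is nonempty. *)
Lemma VAL_of_SAT n q : VAL n q (SATfun n (q ++ flatten (map tbits [:: TVar 0; TAnd]))).
Proof.
rewrite /VAL; case Ed: (decode n q) => [[[|m ms] f]|] //.
have /andP[/andP[m0 _] Hf] := decodeP Ed.
rewrite /SATfun (decode_cat (us := [:: TVar 0; TAnd]) (g := FAnd f (FVar 0)) Ed) //; last first.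
  by rewrite /= in Hf *; rewrite Hf ltn_addr.
have E (t : m.-tuple bool) : qval false ms m (extend env0 0 t) (FAnd f (FVar 0)) =
    nth false t 0 && qval false ms m (extend env0 0 t) f.
  by rewrite qval_and_var0 // /extend add0n (m0 : 0 < m).
case: ifP => // /existsP[t Ht] /=; case: existsP => [[t' Ht']|Hno].
  by exists t'; move: Ht'; rewrite add0n E => /andP[-> ->].
exists t; split=> //; apply/negbTE/negP => t0; apply: Hno.
by exists t; rewrite add0n E t0.
Qed.

(** The query word lies on [SX] with its last bit on top, so it is reversed onto [SH] before it is
    emitted. *)
Definition ask_first_true : program bool :=
  pbind (copy SX SH nobits) (fun _ =>
  pbind (copy SH SX bits_of) (fun _ =>
  pbind (pemits (flatten (map tbits [:: TVar 0; TAnd]))) (fun _ =>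
  pbind pask (fun y =>
  pbind (clear SX SL) (fun _ =>
  pskip y))))).

Lemma run_ask_first_true n L l r q :
  (forall w y, orc w y -> SAT n w y) -> size q <= L ->
  run ask_first_true (48 * L + 20) (mk l r (map lbit (rev q)) [::] [::] [::]) [::]
    (fun b st' w' => [/\ VAL n q b, w' = [::] & st' = mk l r [::] [::] [::] [::]]).
Proof.
move=> Horc HL.
have Hb a : size (bits_of a) <= 11 by case: a => [g|[]].
apply: run_copy_seq => //; rewrite !mkE ?size_map ?size_rev; first lia.
rewrite cats0 -map_rev revK nobits_nil.
apply: (run_less (t := 32 * L + 18)); first lia.
apply: run_copy_seq => //; rewrite !mkE ?size_map; first lia.
rewrite bits_of_lbit cats0.
apply: (run_less (t := 16 * L + 16)); first lia.
apply: run_emits_seq; first by rewrite /=; lia.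
apply: (run_less (t := 16 * L + 8)); first by rewrite /=; lia.
apply: run_ask; first lia.
move=> y /Horc Hy.
apply: run_clear_seq => //; rewrite !mkE ?size_rev ?size_map; first lia.
by apply: run_skip; [lia|split=> //; rewrite Hy; exact: VAL_of_SAT].
Qed.

End Programs.

(** * Simulating an oracle machine *)

Section Simulation.
Variables (M : OTM) (ans : prog stk (symbol (otm_G M)) bool).

Local Notation symb := (symbol (otm_G M)).
Local Notation lt := (@inl (otm_G M) letter).
Local Notation control := (otm_Q M * otm_G M)%type.

(** An exhausted stack stands for the unvisited part of the tape, where [tape_move] supplies a
    blank. *)
Definition popped (o : option symb) : otm_G M :=
  if o is Some (inl a) then a else otm_blank M.

Definition sim_move (d : move) (q : otm_Q M) (g : otm_G M) : prog stk symb (control + bool) :=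
  match d with
  | MoveL => pbind (ppop SL) (fun o =>
      pbind (ppush SR (lt g)) (fun _ => pskip (inl (q, popped o))))
  | MoveR => pbind (ppop SR) (fun o =>
      pbind (ppush SL (lt g)) (fun _ => pskip (inl (q, popped o))))
  | Stay => pskip (inl (q, g))
  end.

(** The scanned symbol is part of the control state. The simulated query word is kept on [SX]
    because the real query tape serves the queries of [ans]. *)
Definition sim_step (c : control) : prog stk symb (control + bool) :=
  match otm_delta c.1 c.2 with
  | Act q g d ob =>
    if ob is Some b then pbind (ppush SX (lbit _ b)) (fun _ => sim_move d q g)
    else sim_move d q g
  | Ask f => pbind ans (fun y => pskip (inl (f y, c.2)))
  | Stop b => pskip (inr b)
  end.

Definition config_store (c : config M) : store stk symb :=
  mk (map lt (tleft (ctape c))) (map lt (tright (ctape c)))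
     (map (lbit _) (rev (cquery c))) [::] [::] [::].

Variables (phi phi' : promise) (a : nat -> nat).
Hypothesis ansP : forall L l r q, size q <= L ->
  run phi ans (a L) (mk l r (map (lbit _) (rev q)) [::] [::] [::]) [::]
    (fun b st' w' => [/\ phi' q b, w' = [::] & st' = mk l r [::] [::] [::] [::]]).

(** Whatever admissible answer [ans] returns, it continues one of the paths of [M], all of which are
    good by hypothesis. A step appends at most one bit, so no query word exceeds [L] and a simulated
    step costs at most [a L + 6]. *)
Lemma run_sim S L t c : all_paths_ok phi' S t c -> size (cquery c) + t <= L ->
  run phi (@ploop _ _ control bool sim_step (cstate c, Defs.thead (ctape c)))
    (t * (a L + 6)) (config_store c) [::] (fun b _ _ => S b).
Proof.
elim: t c => [//|t IH] [q [l g r] w] /= Hok HL.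
have IH' c' : all_paths_ok phi' S t c' -> size (cquery c') + t <= L ->
    run phi (@ploop _ _ control bool sim_step (cstate c', Defs.thead (ctape c')))
    (t.+1 * (a L + 6) - (a L + 6)) (config_store c') [::] (fun b _ _ => S b).
  by rewrite mulSn addKn; exact: IH.
apply: (run_loop (t1 := a L + 6)); first by rewrite mulSn leq_addr.
rewrite /sim_step /=; case: (otm_delta q g) Hok => [q' g' d ob|f|b] Hok; last first.
- by apply: run_skip; first lia.
- apply: (run_bind (t1 := a L)); first lia.
  apply: run_mono (ansP _ _ (_ : size w <= L)) => //; last by lia.
  move=> y st' w' [/Hok{}Hok -> ->]; apply: run_skip; first lia.
  by apply: (IH' _ Hok) => /=; lia.
have move_ok t' w' : 3 <= t' ->
    all_paths_ok phi' S t
      (Config q' (tape_move (otm_blank M) d (Tape l g' r)) w') -> size w' + t <= L ->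
    run phi (sim_move d q' g') t' (mk (map lt l) (map lt r) (map (lbit _) (rev w')) [::] [::] [::])
      [::] (fun r0 st' w' => match r0 with
        | inl a' => run phi (@ploop _ _ control bool sim_step a')
            (t.+1 * (a L + 6) - (a L + 6)) st' w' (fun b _ _ => S b)
        | inr b => S b
        end).
  move=> Ht' Hok' Hw'; have := IH' _ Hok' Hw'; case: d {Hok Hok'} => /= Hrun.
  - apply: run_pop; first lia.
    apply: run_push; first lia.
    apply: run_skip; first lia.
    by move: Hrun; rewrite /config_store !mkE; case: (l).
  - apply: run_pop; first lia.
    apply: run_push; first lia.
    apply: run_skip; first lia.
    by move: Hrun; rewrite /config_store !mkE; case: (r).
  - by apply: run_skip; first lia.
rewrite /config_store /=.
case: ob Hok => [b|] Hok.
  apply: run_push; first lia.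
  rewrite !mkE; have -> : lbit _ b :: map (lbit _) (rev w) = map (lbit _) (rev (w ++ [:: b])).
    by rewrite rev_cat.
  by apply: move_ok => //; rewrite ?size_cat /=; lia.
by rewrite cats0 in Hok; apply: move_ok => //; lia.
Qed.

Definition load_out (_ : unit) (s : symb) : seq symb :=
  if s is inr (LBit b) then [:: lt (otm_sym M b)] else [::].

(** The input arrives with its last bit on top of [ST]; the single reversal onto [SR] brings the
    first bit to the top, where it is popped as the initially scanned symbol. *)
Definition sim_main : prog stk symb bool :=
  pbind (@stream _ unit ST SR (fun _ _ => tt) load_out (@nobits _) tt) (fun _ =>
  pbind (ppop SR) (fun o =>
  @ploop _ _ control bool sim_step (otm_start M, popped o))).

Lemma run_sim_main S t x : 0 < size x -> all_paths_ok phi' S t (init_config M x) ->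
  run phi sim_main (16 * size x + 3 + t * (a t + 6))
    [ffun i => if i == ST then rev (map (lbit _) x) else [::]] [::] (fun b _ _ => S b).
Proof.
move=> x0 Hok.
have -> : [ffun i => if i == ST then rev (map (lbit _) x) else [::]] =
    mk [::] [::] [::] [::] (rev (map (lbit (otm_G M)) x)) [::].
  by apply/ffunP => -[]; rewrite !ffunE.
apply: run_stream_seq => //; rewrite ?mkE ?size_rev ?size_map; [|lia|].
  by move=> ? [g|[]].
have -> : souts (fun _ _ => tt) load_out tt (rev (map (lbit _) x)) =
    rev (map (fun b => lt (otm_sym M b)) x).
  by rewrite -!map_rev; elim: (rev x) => [//|b s IH] /=; rewrite IH.
rewrite revK nobits_nil !cats0; apply: run_pop; first lia.
rewrite !mkE; apply: (run_less (t := t * (a t + 6))); first lia.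
have := run_sim (L := t) Hok (leqnn t); rewrite /config_store.
by case: x x0 {Hok} => [//|b x] _; rewrite /= -map_comp.
Qed.

End Simulation.

(** The answering program is required for every [G] because it shares its stacks with the tape
    symbols of the simulated machine, which is known only once the reduction is given. *)
Lemma Phat_simulate (phi phi' phi1 : promise) (ans : forall G, prog stk (symbol G) bool) a :
  poly_bounded a ->
  (forall G L l r q, size q <= L ->
     run phi (ans G) (a L) (mk l r (map (lbit _) (rev q)) [::] [::] [::]) [::]
     (fun b st' w' => [/\ phi' q b, w' = [::] & st' = mk l r [::] [::] [::] [::]])) ->
  Phat phi' phi1 -> Phat phi phi1.
Proof.
move=> Ha Hans [M [p Hp]].
(* This is the time of [sim_main], with query words bounded by the running time [peval p m]; the
   bound on [r] below is the cost of compiling to one tape. *)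
pose T m := 16 * m + 3 + peval p m * (a (peval p m) + 6).
have [r Hr] : exists r, forall m, T m * (2 * (m + T m) + 4) + 2 <= peval r m.
  have HT : poly_bounded T.
    by do ?[exact: poly_bounded_const|exact: poly_bounded_id|exact: poly_bounded_peval
           |exact: (poly_bounded_comp Ha (poly_bounded_peval p))|apply: poly_bounded_add|apply: poly_bounded_mul].
  apply: poly_bounded_le.
  by do ?[exact: poly_bounded_const|exact: poly_bounded_id|exact: HT
         |apply: poly_bounded_add|apply: poly_bounded_mul].
exists (compile (sim_main (ans (otm_G M))) ST (@lbit _)), r => x x0.
apply: all_paths_mono (Hr _) _; apply: run_compile => //.
exact: (run_sim_main (Hans _) x0 (Hp x x0)).
Qed.

Theorem theorem11 (n : nat) : 1 <= n ->
  forall phi1 : promise, is_promise phi1 ->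
    (Phat (VAL n) phi1 <-> Phat (SAT n) phi1).
Proof.
move=> _ phi1 _; split.
  apply: (@Phat_simulate _ _ _ ask_first_true (fun L => 48 * L + 20)).
    by do ?[exact: poly_bounded_const|exact: poly_bounded_id
           |apply: poly_bounded_add|apply: poly_bounded_mul].
  by move=> *; exact: run_ask_first_true.
apply: (@Phat_simulate _ _ _ (fun G => @decide G n) (decide_time n)).
  exact: poly_bounded_decide_time.
by move=> *; exact: run_decide.
Qed.
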